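(* Let $H_1=\begin{bmatrix} f_1&u_1\\ g_1&v_1\end{bmatrix}$ and $H_2=\begin{bmatrix} f_2&u_2\\ g_2&v_2\end{bmatrix}$ be $2\times 2$ matrices with entries in $L^\infty$. Put $$W_L=\begin{bmatrix} V(\bar f_1)_-\\ (g_1)_-\end{bmatrix}\otimes\begin{bmatrix} V(f_2)_-\\ (\bar u_2)_-\end{bmatrix}-\begin{bmatrix} V(\bar u_1)_-\\ (v_1)_-\end{bmatrix}\otimes\begin{bmatrix} V(g_2)_-\\ (\bar v_2)_-\end{bmatrix},$$ $$W_R=\begin{bmatrix} V(\bar f_2)_-\\ (g_2)_-\end{bmatrix}\otimes\begin{bmatrix} V(f_1)_-\\ (\bar u_1)_-\end{bmatrix}-\begin{bmatrix} V(\bar u_2)_-\\ (v_2)_-\end{bmatrix}\otimes\begin{bmatrix} V(g_1)_-\\ (\bar v_1)_-\end{bmatrix}.$$ Assume $W_L=W_R=0$. Then $R_{H_1}R_{H_2}=R_{H_2}R_{H_1}$ if and only if one of the following statements holds. $(1)$ $\bar f_1,\bar f_2,g_1,g_2,\bar u_1,\bar u_2,v_1,v_2\in H^\infty$. $(2)$ $\bar f_1,\bar f_2,g_1,g_2,\bar u_2,(\bar f_2-\bar v_2)\bar u_1\in H^\infty$, and $v_2$ is constant. $(\hat 2)$ $\bar f_1,\bar f_2,g_1,g_2,\bar u_1,(\bar f_1-\bar v_1)\bar u_2\in H^\infty$, and $v_1$ is constant. $(3)$ $g_2,\bar u_1,\bar u_2,v_1,v_2,(f_2-v_2)g_1\in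 H^\infty$, and $f_2$ is constant. $(\hat 3)$ $g_1,\bar u_1,\bar u_2,v_1,v_2,(f_1-v_1)g_2\in H^\infty$, and $f_1$ is constant. $(4)$ $g_2,\bar u_2,(\bar f_2-\bar v_2)\bar u_1,(f_2-v_2)g_1\in H^\infty$, and $f_2$ and $v_2$ are constant. $(\hat 4)$ $g_1,\bar u_1,(\bar f_1-\bar v_1)\bar u_2,(f_1-v_1)g_2\in H^\infty$, and $f_1$ and $v_1$ are constant. $(5)$ $\bar f_1,\bar f_2,g_1,g_2,\bar v_1,\bar v_2,(\bar f_1-\bar v_1)\bar u_2-(\bar f_2-\bar v_2)\bar u_1\in H^\infty$. $(6)$ $g_1,g_2,\bar u_1,\bar u_2\in H^\infty$, and $f_2$ and $v_1$ are constants. $(\hat 6)$ $g_1,g_2,\bar u_1,\bar u_2\in H^\infty$, and $f_1$ and $v_2$ are constants. $(7)$ $g_1,g_2,\bar u_2,\bar v_1,\bar v_2,(\bar f_2-\bar v_2)\bar u_1\in H^\infty$, and $f_2$ is constant. $(\hat 7)$ $g_1,g_2,\bar u_1,\bar v_1,\bar v_2,(\bar f_1-\bar v_1)\bar u_2\in H^\infty$, and $f_1$ is constant. $(8)$ There exists a nonzero constant $\lambda$ such that $g_1,g_2,\bar f_1-\bar\lambda\bar u_1,\bar v_2-\bar\lambda\bar u_2,\bar f_1\bar f_2+\bar v_1\bar v_2-\bar f_1\bar v_2\in H^\infty$, and $f_2$ and $v_1$ are constant. $(\hat 8)$ There exists a nonzero constant $\mu$ such that $g_1,g_2,\bar f_2-\bar\mu\bar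 u_2,\bar v_1-\bar\mu\bar u_1,\bar f_1\bar f_2+\bar v_1\bar v_2-\bar f_2\bar v_1\in H^\infty$, and $f_1$ and $v_2$ are constant. $(9)$ $f_1,f_2,\bar u_1,\bar u_2,v_1,v_2,(f_2-v_2)g_1-(f_1-v_1)g_2\in H^\infty$. $(10)$ $f_1,f_2,g_2,\bar u_1,\bar u_2,(f_2-v_2)g_1\in H^\infty$, and $v_2$ is constant. $(\hat{10})$ $f_1,f_2,g_1,\bar u_1,\bar u_2,(f_1-v_1)g_2\in H^\infty$, and $v_1$ is constant. $(11)$ There exists a nonzero constant $\lambda$ such that $\bar u_1,\bar u_2,g_1-\lambda v_1,g_2-\lambda f_2,f_1f_2+v_1v_2-v_1f_2\in H^\infty$, and $f_1$ and $v_2$ are constant. $(\hat{11})$ There exists a nonzero constant $\mu$ such that $\bar u_1,\bar u_2,g_2-\mu v_2,g_1-\mu f_1,f_1f_2+v_1v_2-v_2f_1\in H^\infty$, and $f_2$ and $v_1$ are constant. $(12)$ $f_1,f_2,g_1,g_2,\bar u_1,\bar u_2,\bar v_1,\bar v_2\in H^\infty$. $(13)$ There exist two nonzero constants $\lambda$ and $\mu$ such that $\bar f_1-\bar\lambda\bar u_1,\ g_1-\lambda v_1,\ g_2-\lambda f_2,\ \bar v_2-\bar\lambda\bar u_2,\ \bar f_2-\bar\mu\bar u_2,\ g_2-\mu v_2,\ g_1-\mu f_1,\ \bar v_1-\bar\mu\bar u_1\in H^\infty$, and $\lambda f_2v_1-\mu f_1v_2$ is constant.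
   Context: $L^2$ and $L^\infty$ are the Lebesgue spaces of the unit circle $\mathbb T$ with normalized Lebesgue measure. $H^2\subset L^2$ is the Hardy space (functions whose negative Fourier coefficients vanish), $P_+$ is the orthogonal projection of $L^2$ onto $H^2$, $P_-=I-P_+$, and $H^\infty=L^\infty\cap H^2$. A bar denotes complex conjugation. For $x\in L^2$, $x_-=P_-x$. $V$ is the anti-unitary operator on $L^2$ given by $Vx=\bar z\bar x$; $V(x)_-$ means $V(P_-x)$. For vectors $p,q$ in a Hilbert space, $p\otimes q$ is the operator $x\mapsto\langle x,q\rangle p$; columns $\begin{bmatrix} x\\ y\end{bmatrix}$ with $x,y\in L^2$ are vectors of $L^2\oplus L^2$. For $H=\begin{bmatrix} f&u\\ g&v\end{bmatrix}$ with entries in $L^\infty$, the generalized Cauchy singular integral operator with symbol $H$ is the operator on $L^2$ given by $R_Hx=P_+fP_+x+P_-gP_+x+P_+uP_-x+P_-vP_-x$. *)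

(* Defs.v *)
From HB Require Import structures.
From mathcomp Require Import all_boot all_order all_algebra.
From mathcomp Require Import complex.
From mathcomp Require Import all_classical all_reals all_analysis.

Set Implicit Arguments.
Unset Strict Implicit.
Unset Printing Implicit Defensive.

Import Order.TTheory GRing.Theory Num.Theory.
Import numFieldNormedType.Exports.

Local Open Scope classical_set_scope.
Local Open Scope ring_scope.

Section Circle.
Variable R : realType.

Definition circle := {w : R[i] | `|w| == 1}.

Lemma expi_proof (t : R) : `|Complex (cos t) (sin t)| == 1 :> R[i].
Proof. by rewrite normc_def /= cos2Dsin2 sqrtr1. Qed.

Definition expi (t : R) : circle := exist (fun w : R[i] => is_true (`|w| == 1)) _ (expi_proof t).

Definition angles : set R := `[0, pi *+ 2].

(* Elements of L^2 and L^oo are represented by functions on the circle, and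
   equality in these spaces is [aeq]. *)
Definition cfun := circle -> R[i].

Definition ae_circle (P : circle -> Prop) : Prop :=
  {ae @lebesgue_measure R, forall t, angles t -> P (expi t)}.

Definition aeq (x y : cfun) : Prop := ae_circle (fun w => x w = y w).

Definition cmeasurable (x : cfun) : Prop :=
  measurable_fun angles (fun t => complex.Re (x (expi t))) /\
  measurable_fun angles (fun t => complex.Im (x (expi t))).

Definition cintegral (x : cfun) : R[i] :=
  Complex ((pi *+ 2)^-1 *
             \int[lebesgue_measure]_(t in angles) complex.Re (x (expi t)))
          ((pi *+ 2)^-1 *
             \int[lebesgue_measure]_(t in angles) complex.Im (x (expi t))).

Definition L2 : set cfun := [set x | cmeasurable x /\
  (\int[@lebesgue_measure R]_(t in angles)
     (ComplexField.Normc.normc (x (expi t)) ^+ 2)%:E < +oo)%E].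

Definition Linf : set cfun := [set x | cmeasurable x /\
  exists M : R, ae_circle (fun w => ComplexField.Normc.normc (x w) <= M)].

Definition dot (x y : cfun) : R[i] := cintegral (fun w => x w * (y w)^*).

Definition fourier (x : cfun) (n : int) : R[i] := dot x (fun w => sval w ^ n).

Definition H2 : set cfun :=
  [set x | L2 x /\ forall n : int, n < 0 -> fourier x n = 0].

Definition Hinf : set cfun := Linf `&` H2.

(* Orthogonal projection of L^2 onto H^2: [Pplus x] is a representative of the
   element y of H^2 such that x - y is orthogonal to H^2, which is unique up to
   [aeq]; the default value 0 is only used outside L^2. *)
Definition Pplus (x : cfun) : cfun :=
  xget (fun=> 0) [set y | H2 y /\ forall h, H2 h -> dot (x \- y) h = 0].

Definition Pminus (x : cfun) : cfun := x \- Pplus x.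

Definition bar (x : cfun) : cfun := fun w => (x w)^*.

Definition V (x : cfun) : cfun := fun w => (sval w)^* * (x w)^*.

(* The arguments are in row order: this is R_H for H = [f u; g v]. *)
Definition cauchy_op (f u g v : cfun) (x : cfun) : cfun :=
  Pplus (f \* Pplus x) \+ Pminus (g \* Pplus x)
  \+ Pplus (u \* Pminus x) \+ Pminus (v \* Pminus x).

Definition commute_on_L2 (A B : cfun -> cfun) : Prop :=
  forall x, L2 x -> aeq (A (B x)) (B (A x)).

(* A pair (x, y) is the column [x; y], a vector of L^2 (+) L^2. *)
Definition dot2 (x y : cfun * cfun) : R[i] := dot x.1 y.1 + dot x.2 y.2.

Definition otimes (p q x : cfun * cfun) : cfun * cfun :=
  (dot2 x q \*o p.1, dot2 x q \*o p.2).

Definition sub_op2 (A B : cfun * cfun -> cfun * cfun) (x : cfun * cfun) :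
    cfun * cfun :=
  ((A x).1 \- (B x).1, (A x).2 \- (B x).2).

Definition zero_op2 (A : cfun * cfun -> cfun * cfun) : Prop :=
  forall x, L2 x.1 -> L2 x.2 ->
    aeq (A x).1 (fun=> 0) /\ aeq (A x).2 (fun=> 0).

(* W_L for the symbols [f1 u1; g1 v1] and [f2 u2; g2 v2]; W_R is obtained by
   exchanging the two symbols. *)
Definition W (f1 u1 g1 v1 f2 u2 g2 v2 : cfun) :
    cfun * cfun -> cfun * cfun :=
  sub_op2
    (otimes (V (Pminus (bar f1)), Pminus g1)
            (V (Pminus f2), Pminus (bar u2)))
    (otimes (V (Pminus (bar u1)), Pminus v1)
            (V (Pminus g2), Pminus (bar v2))).

Definition constant_fun (x : cfun) : Prop := exists c : R[i], aeq x (fun=> c).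

End Circle.

(* Main.v *)
Require Import Defs.
From HB Require Import structures.
From mathcomp Require Import all_boot all_order all_algebra.
From mathcomp Require Import complex ring lra zify.
From mathcomp Require Import all_classical all_reals all_analysis.
From mathcomp Require Import measurable_realfun.

Set Implicit Arguments.
Unset Strict Implicit.
Unset Printing Implicit Defensive.

Import Order.TTheory GRing.Theory Num.Theory.
Import numFieldNormedType.Exports.

Local Open Scope ring_scope.

(** Idea of the proof.  On the characters [z^j] the matrix of a product
    [R_1 R_2] is explicit.  For [i, j >= 0], for instance, its entry is
      <P_+ f2 z^j, P_+ conj(f1) z^i> + <P_- g2 z^j, P_- conj(u1) z^i>,
    and if the second term were <P_- f2 z^j, P_- conj(f1) z^i>, the sum would be
    <f2 z^j, conj(f1) z^i>, the Fourier coefficient of [f1 f2] at [i - j].  The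
    condition [W_L = 0] is what permits such a replacement.  It equates two
    rank-one operators, [p (x) q = r (x) s], so one of [p, q] and one of [r, s]
    vanish, or [p = l r] and [s = conj(l) q] for a nonzero scalar [l]
    ([rank_one_eq], [W_types]).  In each of these five cases every entry of
    [R_1 R_2] becomes a Fourier coefficient at [i - j] of a function that depends
    only on the signs of [i] and [j] (the lemmas [has_symbol_PR], ...,
    [has_symbol_scalar]): it is [f1 f2] or [v1 v2] on the diagonal blocks, and
    simple combinations of products on the other two.

    The condition [W_R = 0] does the same for [R_2 R_1].  As [f1 f2 = f2 f1] and
    [v1 v2 = v2 v1], the diagonal blocks agree automatically, and the operators
    commute if and only if the negative coefficients of the lower left symbols
    and the positive coefficients of the upper right symbols agree
    ([commute_symbols]).  Of the 25 pairs of cases four are degenerate and reduce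
    to others; the remaining 21 are the alternatives of the theorem.  What is left for
    each of them is linear algebra in the Fourier coefficients of products, where
    the products of two analytic or of two coanalytic symbols drop out.

    Three facts of analysis are used.  Fourier coefficients determine a function
    ([nullcoef_aeq0]): the functions all of whose coefficients vanish are stable
    under multiplication by trigonometric polynomials, and indicators of arcs are
    bounded limits of such polynomials.  The projection [P_+] exists and truncates
    the Fourier series ([PplusP], [fourier_Pplus]): this is the Riesz-Fischer
    theorem.  The adjoint of [R_H] is an operator of the same form
    ([cauchy_adjoint]), which reduces the equality of two operators to that of
    their matrices without any continuity argument. *)

(** * Integration on the circle and the inner product of L^2 *)

Section ComplexIntegral.
Local Open Scope classical_set_scope.
Local Open Scope ring_scope.
Variable R : realType.
Local Notation C := R[i].
Local Notation mu := (@lebesgue_measure R).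
Local Notation Re := (@complex.Re R).
Local Notation Im := (@complex.Im R).
Implicit Types (x y : cfun R) (f g : R -> R) (a b z : C).

Lemma ReD a b : Re (a + b) = Re a + Re b. Proof. by case: a b => [? ?] [? ?]. Qed.
Lemma ImD a b : Im (a + b) = Im a + Im b. Proof. by case: a b => [? ?] [? ?]. Qed.
Lemma ReM a b : Re (a * b) = Re a * Re b - Im a * Im b.
Proof. by case: a b => [? ?] [? ?]. Qed.
Lemma ImM a b : Im (a * b) = Re a * Im b + Im a * Re b.
Proof. by case: a b => [? ?] [? ?]. Qed.
Lemma ReJ a : Re a^* = Re a. Proof. by case: a. Qed.
Lemma ImJ a : Im a^* = - Im a. Proof. by case: a. Qed.

Lemma ReN a : Re (- a) = - Re a. Proof. by case: a. Qed.
Lemma ImN a : Im (- a) = - Im a. Proof. by case: a. Qed.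

Definition ReImE := (ReD, ImD, ReM, ImM, ReJ, ImJ, ReN, ImN).

Lemma complexP a b : Re a = Re b -> Im a = Im b -> a = b.
Proof. by case: a b => [? ?] [? ?] /= -> ->. Qed.

Definition abs2 z : R := Re z ^+ 2 + Im z ^+ 2.

Lemma abs2_ge0 z : 0 <= abs2 z.
Proof. by rewrite addr_ge0 ?sqr_ge0. Qed.

Lemma abs2M a b : abs2 (a * b) = abs2 a * abs2 b.
Proof. by rewrite /abs2 !ReImE; ring. Qed.

Lemma normc_sqr z : ComplexField.Normc.normc z ^+ 2 = abs2 z.
Proof. by case: z => p q; rewrite /= sqr_sqrtr ?addr_ge0 ?sqr_ge0. Qed.

Lemma abs2E z : z * z^* = Complex (abs2 z) 0.
Proof. by apply: complexP; rewrite !ReImE /abs2 /=; ring. Qed.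

Lemma measurable_angles : measurable (@angles R : set (measurableTypeR R)).
Proof. exact: measurable_itv. Qed.
Local Hint Resolve measurable_angles : core.

Lemma mu_angles : mu (@angles R) = (pi *+ 2)%:E.
Proof.
by rewrite /angles lebesgue_measure_itv /= lte_fin mulrn_wgt0 ?pi_gt0 // oppr0 adde0.
Qed.

Definition angle_integrable f := mu.-integrable (@angles R) (EFin \o f).
Definition angle_measurable f := measurable_fun (@angles R) f.

Lemma angle_integrable_meas f : angle_integrable f -> angle_measurable f.
Proof. by move=> /integrableP[] /measurable_EFinP. Qed.

Lemma angle_integrableD f g : angle_integrable f -> angle_integrable g -> angle_integrable (fun t => f t + g t).
Proof.
move=> hf hg; exact: (integrableD measurable_angles hf hg).
Qed.

Lemma angle_integrableZ (k : R) f : angle_integrable f -> angle_integrable (fun t => k * f t).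
Proof. by move=> hf; apply: (integrableZl measurable_angles k hf). Qed.

Lemma angle_integrableN f : angle_integrable f -> angle_integrable (fun t => - f t).
Proof. by move=> /(angle_integrableZ (-1)); under eq_fun do rewrite mulN1r. Qed.

Lemma angle_integrableB f g : angle_integrable f -> angle_integrable g -> angle_integrable (fun t => f t - g t).
Proof. by move=> hf hg; apply: angle_integrableD => //; apply: angle_integrableN. Qed.

Lemma ae_sub (P Q : R -> Prop) : (forall t, P t -> Q t) ->
  {ae mu, forall t, P t} -> {ae mu, forall t, Q t}.
Proof.
move=> h p; have F : Filter (almost_everywhere mu) by exact: ae_filter_ringOfSetsType.
by apply: filterS p.
Qed.

Lemma ae_sub2 (P P' Q : R -> Prop) : (forall t, P t -> P' t -> Q t) ->
  {ae mu, forall t, P t} -> {ae mu, forall t, P' t} -> {ae mu, forall t, Q t}.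
Proof.
move=> h p q; have F : Filter (almost_everywhere mu) by exact: ae_filter_ringOfSetsType.
by apply: filterS2 p q.
Qed.

(** Dominated convergence for a constant sequence: it is the domination criterion
    that tolerates a bound valid only almost everywhere, as [L^oo] requires. *)
Lemma angle_integrable_le_ae f g : angle_measurable f -> {ae mu, forall t, angles t -> `|f t| <= g t} ->
  angle_integrable g -> angle_integrable f.
Proof.
move=> /measurable_EFinP mf fg hg.
have [] // := @dominated_convergence _ _ _ mu _ measurable_angles
  (fun=> EFin \o f) (EFin \o f) (EFin \o g) (fun=> mf) mf _ hg _.
  by apply: aeW => t _; exact: cvg_cst.
by move: fg; apply: ae_sub => t h _ At; rewrite lee_fin h.
Qed.

Lemma angle_integrable_le f g : angle_measurable f -> (forall t, angles t -> `|f t| <= g t) ->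
  angle_integrable g -> angle_integrable f.
Proof. by move=> mf fg; apply: angle_integrable_le_ae => //; apply: aeW. Qed.

Lemma angle_integrable_cst (k : R) : angle_integrable (cst k).
Proof.
apply/integrableP; split; first exact/measurable_EFinP/measurable_cst.
rewrite (_ : (\int[_]_(x in _) _)%E = (\int[mu]_(t in @angles R) cst `|k|%:E t)%E) //.
by rewrite integral_cst // [X in (_ * X)%E]mu_angles -EFinM ltry.
Qed.

Local Notation RI f := (Rintegral mu (@angles R) f).

Lemma RI_cst (k : R) : RI (cst k) = k * (pi *+ 2).
Proof. by rewrite Rintegral_cst // [X in fine X]mu_angles. Qed.

Lemma RI_ae f g : angle_measurable f -> angle_measurable g -> {ae mu, forall t, angles t -> f t = g t} -> RI f = RI g.
Proof.
move=> mf mg fg; rewrite /Rintegral; congr fine; apply: ae_eq_integral => //.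
- exact/measurable_EFinP.
- exact/measurable_EFinP.
- by move: fg; apply: ae_sub => t h /h ->.
Qed.

Definition cintegrable x := angle_integrable (fun t => Re (x (expi t))) /\ angle_integrable (fun t => Im (x (expi t))).

Lemma cintegrable_meas x : cintegrable x -> cmeasurable x.
Proof. by case=> ? ?; split; apply: angle_integrable_meas. Qed.

Lemma cintegralD x y : cintegrable x -> cintegrable y ->
  cintegral (x \+ y) = cintegral x + cintegral y.
Proof.
move=> [hx hx'] [hy hy']; apply: complexP; rewrite ReImE /= -mulrDr; congr (_ * _).
  by under eq_Rintegral do rewrite ReD; rewrite RintegralD.
by under eq_Rintegral do rewrite ImD; rewrite RintegralD.
Qed.

Lemma cintegralZ (k : C) x : cintegrable x ->
  cintegral (k \*o x) = k * cintegral x.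
Proof.
move=> [hx hx']; apply: complexP; rewrite ReImE /=.
  under eq_Rintegral do rewrite ReM.
  rewrite RintegralB //; [|exact: angle_integrableZ|exact: angle_integrableZ].
  by rewrite !RintegralZl //; ring.
under eq_Rintegral do rewrite ImM.
rewrite RintegralD //; [|exact: angle_integrableZ|exact: angle_integrableZ].
by rewrite !RintegralZl //; ring.
Qed.

Lemma cintegral_conj x : cintegrable x -> cintegral (bar x) = (cintegral x)^*.
Proof.
move=> [hx hx']; apply: complexP; rewrite ReImE /=.
  by under eq_Rintegral do rewrite ReJ.
under eq_Rintegral do rewrite ImJ -mulN1r.
by rewrite RintegralZl //; ring.
Qed.

Lemma cintegral_ae x y : cmeasurable x -> cmeasurable y -> aeq x y -> cintegral x = cintegral y.
Proof.
move=> [mx mx'] [my my'] xy; rewrite /cintegral; congr (Complex (_ * _) (_ * _)).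
  by apply: RI_ae => //; move: xy; apply: ae_sub => t h /h ->.
by apply: RI_ae => //; move: xy; apply: ae_sub => t h /h ->.
Qed.

Lemma aeq_refl x : aeq x x. Proof. exact: aeW. Qed.
Lemma aeq_op2 (F : C -> C -> C) x x' y y' : aeq x x' -> aeq y y' ->
  aeq (fun w => F (x w) (y w)) (fun w => F (x' w) (y' w)).
Proof. by apply: ae_sub2 => t h k At; rewrite h // k. Qed.
Lemma cmeasurableD x y : cmeasurable x -> cmeasurable y -> cmeasurable (x \+ y).
Proof.
move=> [hx hx'] [hy hy']; split=> /=.
  by under eq_fun do rewrite ReD; apply: measurable_funD.
by under eq_fun do rewrite ImD; apply: measurable_funD.
Qed.

Lemma cmeasurableM x y : cmeasurable x -> cmeasurable y -> cmeasurable (x \* y).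
Proof.
move=> [hx hx'] [hy hy']; split=> /=.
  by under eq_fun do rewrite ReM; apply: measurable_funB; apply: measurable_funM.
by under eq_fun do rewrite ImM; apply: measurable_funD; apply: measurable_funM.
Qed.

Lemma cmeasurable_cst (k : C) : cmeasurable (fun=> k : C).
Proof. by split; apply: measurable_cst. Qed.

Lemma cmeasurableZ (k : C) x : cmeasurable x -> cmeasurable (k \*o x).
Proof. exact: cmeasurableM (cmeasurable_cst k). Qed.

Lemma cmeasurable_bar x : cmeasurable x -> cmeasurable (bar x).
Proof.
move=> [hx hx']; split; rewrite /bar.
  by under eq_fun do rewrite ReJ.
by under eq_fun do rewrite ImJ; apply: measurable_funN.
Qed.

Definition norm2 x : R -> R := fun t => abs2 (x (expi t)).

Lemma angle_measurable_norm2 x : cmeasurable x -> angle_measurable (norm2 x).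
Proof.
by move=> [hx hx']; apply: measurable_funD; apply: measurable_funX.
Qed.

(** The finiteness of the integral in [L2] in a form that the theory of integrable
    functions can use. *)
Lemma L2P x : L2 x <-> cmeasurable x /\ angle_integrable (norm2 x).
Proof.
have E : (\int[mu]_(t in @angles R) (ComplexField.Normc.normc (x (expi t)) ^+ 2)%:E =
          \int[mu]_(t in @angles R) `|(EFin \o norm2 x) t|)%E.
  by apply: eq_integral => t _; rewrite normc_sqr /= ger0_norm ?abs2_ge0.
split=> -[mx hx]; split=> //.
  apply/integrableP; split; first by apply/measurable_EFinP; exact: angle_measurable_norm2.
  by rewrite -E.
by move/integrableP: hx => [_]; rewrite -E.
Qed.

Lemma L2_meas x : L2 x -> cmeasurable x. Proof. by case. Qed.

Lemma L2_dom x g : cmeasurable x -> angle_integrable g -> (forall t, angles t -> norm2 x t <= g t) -> L2 x.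
Proof.
move=> mx hg xg; apply/L2P; split=> //; apply: angle_integrable_le (angle_measurable_norm2 mx) _ hg.
by move=> t At; rewrite ger0_norm ?abs2_ge0 // xg.
Qed.

Lemma L2D x y : L2 x -> L2 y -> L2 (x \+ y).
Proof.
move=> /L2P[mx hx] /L2P[my hy].
apply: (@L2_dom _ (fun t => 2 * norm2 x t + 2 * norm2 y t)).
- exact: cmeasurableD.
- by apply: angle_integrableD; apply: angle_integrableZ.
- move=> t _; rewrite /norm2 /abs2 /= !ReImE.
  have := sqr_ge0 (Re (x (expi t)) - Re (y (expi t))).
  have := sqr_ge0 (Im (x (expi t)) - Im (y (expi t))); nra.
Qed.

Lemma L2Z (k : C) x : L2 x -> L2 (k \*o x).
Proof.
move=> /L2P[mx hx].
apply: (@L2_dom _ (fun t => abs2 k * norm2 x t)).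
- exact: cmeasurableZ.
- exact: angle_integrableZ.
- by move=> t _; rewrite /norm2 /= abs2M.
Qed.

Lemma L2_bar x : L2 x -> L2 (bar x).
Proof.
move=> /L2P[mx hx]; apply/L2P; split; first exact: cmeasurable_bar.
by move: hx; congr (angle_integrable _); apply/funext => t; rewrite /norm2 /abs2 /bar !ReImE sqrrN.
Qed.

Lemma cfunBE x y : x \- y = x \+ ((-1) \*o y).
Proof. by apply/funext => w /=; rewrite mulN1r. Qed.

Lemma L2B x y : L2 x -> L2 y -> L2 (x \- y).
Proof. by move=> hx hy; rewrite cfunBE; apply: L2D => //; apply: L2Z. Qed.

Lemma L2_cst (k : C) : L2 (fun=> k : C).
Proof.
by apply/L2P; split; [exact: cmeasurable_cst|exact: angle_integrable_cst].
Qed.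

(** By the inequality 2 |p q| <= p^2 + q^2. *)
Lemma L2_mul_cintegrable x y : L2 x -> L2 y -> cintegrable (x \* y).
Proof.
move=> /L2P[mx hx] /L2P[my hy]; have [mxy mxy'] := cmeasurableM mx my.
have hxy : angle_integrable (fun t => norm2 x t + norm2 y t) by apply: angle_integrableD.
split; apply: angle_integrable_le hxy => // t _; rewrite /norm2 /abs2 /= !ReImE ler_norml.
  set p := Re _; set q := Im _; set r := Re _; set s := Im _.
  have := (sqr_ge0 (p - r), sqr_ge0 (q - s), sqr_ge0 (p + r), sqr_ge0 (q + s)).
  by case=> -[] [] *; apply/andP; split; nra.
set p := Re _; set q := Im _; set r := Im _; set s := Re _.
have := (sqr_ge0 (p - q), sqr_ge0 (r - s), sqr_ge0 (p + q), sqr_ge0 (r + s)).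
by case=> -[] [] *; apply/andP; split; nra.
Qed.

Lemma L2_cintegrable x : L2 x -> cintegrable x.
Proof.
move=> hx; have := L2_mul_cintegrable hx (L2_cst 1).
by congr cintegrable; apply/funext => w /=; rewrite mulr1.
Qed.

Implicit Types u v : cfun R.

Lemma Linf_meas x : Linf x -> cmeasurable x. Proof. by case. Qed.

Lemma LinfP x : Linf x <-> cmeasurable x /\
  exists2 M : R, 0 <= M & {ae mu, forall t, angles t -> norm2 x t <= M}.
Proof.
split=> -[mx [M]].
  move=> h; split=> //; exists (M ^+ 2); first exact: sqr_ge0.
  move: h; apply: ae_sub => t h At; rewrite /norm2 -normc_sqr.
  have n0 : 0 <= ComplexField.Normc.normc (x (expi t)).
    by case: (x _) => ? ? /=; apply: sqrtr_ge0.
  by rewrite ler_sqr ?nnegrE ?h // (le_trans n0) // h.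
move=> M0 h; split=> //; exists (Num.sqrt M).
move: h; apply: ae_sub => t h At; have := h At; rewrite /norm2 -normc_sqr => h'.
have n0 : 0 <= ComplexField.Normc.normc (x (expi t)).
  by case: (x _) => ? ? /=; apply: sqrtr_ge0.
by rewrite -(ler_sqr) ?nnegrE ?sqrtr_ge0 // sqr_sqrtr.
Qed.

Lemma L2_mul u x : Linf u -> L2 x -> L2 (u \* x).
Proof.
move=> /LinfP[mu_ [M M0 uM]] /L2P[mx hx].
have mu_x := cmeasurableM mu_ mx; apply/L2P; split=> //.
apply: angle_integrable_le_ae (angle_measurable_norm2 mu_x) _ (angle_integrableZ M hx).
move: uM; apply: ae_sub => t h At.
by rewrite /norm2 /= abs2M ger0_norm ?mulr_ge0 ?abs2_ge0 // ler_wpM2r ?abs2_ge0 ?h.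
Qed.

Lemma Linf_L2 u : Linf u -> L2 u.
Proof.
move=> hu; have := L2_mul hu (L2_cst 1).
by congr L2; apply/funext => w /=; rewrite mulr1.
Qed.

Lemma LinfM u v : Linf u -> Linf v -> Linf (u \* v).
Proof.
move=> /LinfP[mu_ [M M0 uM]] /LinfP[mv_ [N N0 vN]]; apply/LinfP.
split; [exact: cmeasurableM|exists (M * N); first exact: mulr_ge0].
move: uM vN; apply: ae_sub2 => t h k At.
by rewrite /norm2 /= abs2M ler_pM ?abs2_ge0 ?h ?k.
Qed.

Lemma Linf_cst (k : C) : Linf (fun=> k : C).
Proof.
apply/LinfP; split; first exact: cmeasurable_cst.
by exists (abs2 k); [exact: abs2_ge0|exact: aeW].
Qed.

Lemma LinfD u v : Linf u -> Linf v -> Linf (u \+ v).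
Proof.
move=> /LinfP[mu_ [M M0 uM]] /LinfP[mv_ [N N0 vN]]; apply/LinfP.
split; [exact: cmeasurableD|exists (2 * M + 2 * N)].
  by rewrite addr_ge0 // mulr_ge0.
move: uM vN; apply: ae_sub2 => t h k At; have := h At; have := k At.
rewrite /norm2 /abs2 /= !ReImE.
have := sqr_ge0 (Re (u (expi t)) - Re (v (expi t))).
have := sqr_ge0 (Im (u (expi t)) - Im (v (expi t))); nra.
Qed.

Lemma LinfZ (k : C) u : Linf u -> Linf (k \*o u).
Proof. exact: LinfM (Linf_cst k). Qed.

Lemma LinfB u v : Linf u -> Linf v -> Linf (u \- v).
Proof. by move=> hu hv; rewrite cfunBE; apply: LinfD => //; apply: LinfZ. Qed.

Lemma Linf_bar u : Linf u -> Linf (bar u).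
Proof.
move=> /LinfP[mu_ [M M0 uM]]; apply/LinfP; split; first exact: cmeasurable_bar.
exists M => //; move: uM; apply: ae_sub => t h /h.
by rewrite /norm2 /abs2 /bar !ReImE sqrrN.
Qed.

Lemma dot_cintegrable x y : L2 x -> L2 y -> cintegrable (fun w => x w * (y w)^*).
Proof. by move=> hx hy; apply: (L2_mul_cintegrable hx (L2_bar hy)). Qed.

Lemma dotDl x x' y : L2 x -> L2 x' -> L2 y -> dot (x \+ x') y = dot x y + dot x' y.
Proof.
move=> hx hx' hy; rewrite /dot -cintegralD; try exact: dot_cintegrable.
by congr cintegral; apply/funext => w /=; rewrite mulrDl.
Qed.

Lemma dotZl (k : C) x y : L2 x -> L2 y -> dot (k \*o x) y = k * dot x y.
Proof.
move=> hx hy; rewrite /dot -cintegralZ; last exact: dot_cintegrable.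
by congr cintegral; apply/funext => w /=; rewrite mulrA.
Qed.

Lemma dotC x y : L2 x -> L2 y -> dot y x = (dot x y)^*.
Proof.
move=> hx hy; rewrite /dot -cintegral_conj; last exact: dot_cintegrable.
by congr cintegral; apply/funext => w; rewrite /bar /= rmorphM /= conjCK mulrC.
Qed.

Lemma dotBl x x' y : L2 x -> L2 x' -> L2 y -> dot (x \- x') y = dot x y - dot x' y.
Proof.
by move=> hx hx' hy; rewrite cfunBE dotDl ?dotZl ?mulN1r //; apply: L2Z.
Qed.

Lemma dotDr x y y' : L2 x -> L2 y -> L2 y' -> dot x (y \+ y') = dot x y + dot x y'.
Proof.
move=> hx hy hy'; rewrite (dotC _ hx) ?dotDl ?rmorphD /= -?dotC //; exact: L2D.
Qed.

Lemma dotBr x y y' : L2 x -> L2 y -> L2 y' -> dot x (y \- y') = dot x y - dot x y'.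
Proof.
move=> hx hy hy'; rewrite (dotC _ hx) ?dotBl ?rmorphB /= -?dotC //; exact: L2B.
Qed.

Lemma dotZr (k : C) x y : L2 x -> L2 y -> dot x (k \*o y) = k^* * dot x y.
Proof.
move=> hx hy; rewrite (dotC _ hx) ?dotZl ?rmorphM /= -?dotC //; exact: L2Z.
Qed.

Lemma dot_aeq x x' y y' : L2 x -> L2 x' -> L2 y -> L2 y' -> aeq x x' -> aeq y y' ->
  dot x y = dot x' y'.
Proof.
move=> hx hx' hy hy' xx yy; apply: cintegral_ae.
- exact: cintegrable_meas (dot_cintegrable hx hy).
- exact: cintegrable_meas (dot_cintegrable hx' hy').
- exact: (aeq_op2 (fun a b => a * b^* )).
Qed.

(** Both sides are integrals of one and the same function. *)
Lemma dot_mul u x y : dot (u \* x) y = dot x (bar u \* y).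
Proof.
rewrite /dot; congr cintegral; apply/funext => w.
by rewrite /bar /= rmorphM /= conjCK [u w * x w]mulrC mulrA.
Qed.

Definition nrm2 x : R := (pi *+ 2)^-1 * RI (norm2 x).

Lemma dotxx x : dot x x = Complex (nrm2 x) 0.
Proof.
rewrite /dot; under [X in cintegral X]eq_fun do rewrite abs2E.
apply: complexP => //=.
by rewrite RI_cst mul0r mulr0.
Qed.

Lemma pi2_gt0 : 0 < pi *+ 2 :> R.
Proof. by rewrite mulrn_wgt0 ?pi_gt0. Qed.

Lemma nrm2_ge0 x : 0 <= nrm2 x.
Proof.
apply: mulr_ge0; first by rewrite invr_ge0 ltW ?pi2_gt0.
by apply: Rintegral_ge0 => t _; exact: abs2_ge0.
Qed.

Lemma abs2_eq0 z : abs2 z = 0 -> z = 0.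
Proof.
rewrite /abs2 => h; have := (sqr_ge0 (Re z), sqr_ge0 (Im z)).
by case=> ? ?; apply: complexP => /=; apply/eqP; rewrite -sqrf_eq0 eq_le; lra.
Qed.

Lemma nrm2_eq0 x : L2 x -> nrm2 x = 0 -> aeq x (fun=> 0).
Proof.
move=> /L2P[mx hx] /eqP; rewrite mulf_eq0 invr_eq0 (gt_eqF pi2_gt0) /= => /eqP x0.
have : ae_eq mu (@angles R) (EFin \o norm2 x) (cst 0%E).
  apply/ae_eq_integral_abs => //; first by apply/measurable_EFinP; exact: angle_measurable_norm2.
  under eq_integral => t _ do rewrite /= ger0_norm ?abs2_ge0 //.
  have fin := integrable_fin_num measurable_angles hx.
  by rewrite -[LHS](fineK fin) -[fine _]/(RI (norm2 x)) x0.
by apply: ae_sub => t h At; apply: abs2_eq0; apply: EFin_inj; exact: h.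
Qed.

End ComplexIntegral.

(** * The characters z^n *)

Section Exponentials.
Local Open Scope classical_set_scope.
Local Open Scope ring_scope.
Variable R : realType.
Local Notation C := R[i].
Local Notation mu := (@lebesgue_measure R).
Local Notation Re := (@complex.Re R).
Local Notation Im := (@complex.Im R).
Implicit Types (x y : cfun R) (w : circle R) (n m : int) (t : R).
Local Hint Resolve measurable_angles : core.

Definition zpow n : cfun R := fun w => sval w ^ n.

Lemma circle_norm w : `|sval w| = 1. Proof. by case: w => w /= /eqP. Qed.

Lemma circle_neq0 w : sval w != 0.
Proof. by rewrite -normr_eq0 circle_norm oner_eq0. Qed.

Lemma circle_conj w : (sval w)^* = (sval w)^-1.
Proof.
apply: (mulfI (circle_neq0 w)); rewrite -normCK circle_norm expr1n mulfV //.
exact: circle_neq0.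
Qed.

Lemma zpowD m n w : zpow (m + n) w = zpow m w * zpow n w.
Proof. by rewrite /zpow expfzDr ?circle_neq0. Qed.

Lemma bar_zpow n : bar (zpow n) = zpow (- n).
Proof.
apply/funext => w; rewrite /bar /zpow.
by rewrite rmorphXz ?unitfE ?circle_neq0 //= circle_conj exprz_inv.
Qed.

Lemma expi_zpow n t :
  sval (expi t) ^ n = Complex (cos (n%:~R * t)) (sin (n%:~R * t)).
Proof.
have P (k : nat) : sval (expi t) ^+ k = Complex (cos (k%:R * t)) (sin (k%:R * t)).
  elim: k => [|k IH]; first by rewrite mul0r cos0 sin0.
  rewrite exprS IH -addn1 natrD mulrDl mul1r cosD sinD.
  by apply: complexP; rewrite ReImE /=; ring.
case: n => n; first by rewrite -exprnP P.
rewrite NegzE -exprz_inv -circle_conj -exprnP -rmorphXn /= P mulrNz.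
apply: complexP; rewrite ReImE /= mulNr ?cosN ?sinN //.
Qed.

Lemma abs2_zpow n w : abs2 (zpow n w) = 1.
Proof.
have := abs2E (zpow n w); rewrite -[(zpow n w)^*]/(bar (zpow n) w) bar_zpow -zpowD subrr.
by rewrite [zpow 0 w]expr0z => -[].
Qed.

Lemma cont_cos (c : R) : continuous (fun t => cos (c * t)).
Proof.
move=> t; apply: (@continuous_comp _ _ _ (fun t => c * t) cos).
  by apply: continuousM; [exact: cvg_cst|exact: cvg_id].
exact: continuous_cos.
Qed.

Lemma cont_sin (c : R) : continuous (fun t => sin (c * t)).
Proof.
move=> t; apply: (@continuous_comp _ _ _ (fun t => c * t) sin).
  by apply: continuousM; [exact: cvg_cst|exact: cvg_id].
exact: continuous_sin.
Qed.

Lemma angle_measurable_cont (f : R -> R) : continuous f -> angle_measurable f.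
Proof.
move=> cf; apply: measurable_funTS.
exact: continuous_measurable_fun.
Qed.

Lemma Linf_zpow n : Linf (zpow n).
Proof.
apply/LinfP; split.
  split.
    under eq_fun do rewrite /zpow expi_zpow /=.
    by apply: angle_measurable_cont; exact: cont_cos.
  under eq_fun do rewrite /zpow expi_zpow /=.
  by apply: angle_measurable_cont; exact: cont_sin.
by exists 1 => //; apply: aeW => t _; rewrite /norm2 abs2_zpow.
Qed.

Lemma L2_zpow n : L2 (zpow n). Proof. exact: Linf_L2 (Linf_zpow n). Qed.

Lemma trig_2pi n : cos (n%:~R * (pi *+ 2)) = 1 :> R /\ sin (n%:~R * (pi *+ 2)) = 0 :> R.
Proof.
have P (k : nat) : cos (k%:R * (pi *+ 2)) = 1 :> R /\ sin (k%:R * (pi *+ 2)) = 0 :> R.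
  rewrite mulr_natl -[_ *+ k]add0r.
  by rewrite (periodicn (@cosD2pi R)) (periodicn (@sinD2pi R)) cos0 sin0.
case: n => n; first exact: P.
have [Pc Ps] := P n.+1.
by rewrite NegzE mulrNz mulNr cosN sinN Pc Ps oppr0.
Qed.

Lemma RI_FTC (f F : R -> R) : continuous f ->
  (forall t, is_derive t 1 F (f t)) ->
  Rintegral mu (@angles R) f = F (pi *+ 2) - F 0.
Proof.
move=> cf dF; have cF t : {for t, continuous F}.
  by apply: differentiable_continuous; apply/derivable1_diffP; case: (dF t).
rewrite /Rintegral (@continuous_FTC2 _ f F) ?pi2_gt0 //.
- exact: continuous_subspaceT.
- split; first by move=> t _; case: (dF t).
  + exact: cvg_at_right_filter (cF _).
  + exact: cvg_at_left_filter (cF _).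
- by move=> t _; rewrite derive1E; case: (dF t).
Qed.

Lemma RI_cos (c : R) : c != 0 -> sin (c * (pi *+ 2)) = 0 ->
  Rintegral mu (@angles R) (fun t => cos (c * t)) = 0.
Proof.
move=> c0 s0.
have dF t : is_derive t 1 (fun t => c^-1 * sin (c * t)) (cos (c * t)).
  have h : is_derive t 1 (fun t => c * t) c.
    by apply: is_derive_eq; rewrite /GRing.scale /= mulr1 ?mulr0 ?scaler0 ?addr0 ?add0r.
  have h2 := @is_derive1_comp _ sin (fun t => c * t) t _ _ (is_derive_sin _) h.
  by apply: is_derive_eq; rewrite /GRing.scale /= ?mulr0 ?addr0 ?add0r; field.
by rewrite (RI_FTC (@cont_cos c) dF); rewrite s0 !mulr0 sin0 mulr0 subrr.
Qed.

Lemma RI_sin (c : R) : c != 0 -> cos (c * (pi *+ 2)) = 1 ->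
  Rintegral mu (@angles R) (fun t => sin (c * t)) = 0.
Proof.
move=> c0 s0.
have dF t : is_derive t 1 (fun t => - c^-1 * cos (c * t)) (sin (c * t)).
  have h : is_derive t 1 (fun t => c * t) c.
    by apply: is_derive_eq; rewrite /GRing.scale /= mulr1 ?mulr0 ?scaler0 ?addr0 ?add0r.
  have h2 := @is_derive1_comp _ cos (fun t => c * t) t _ _ (is_derive_cos _) h.
  by apply: is_derive_eq; rewrite /GRing.scale /= ?mulr0 ?addr0 ?add0r; field.
by rewrite (RI_FTC (@cont_sin c) dF); rewrite s0 !mulr0 cos0 subrr.
Qed.

Lemma cintegral_zpow n : cintegral (zpow n) = (n == 0)%:R.
Proof.
case: eqVneq => [->|n0].
  rewrite (_ : zpow 0 = fun=> 1); last by apply/funext => w; rewrite /zpow expr0z.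
  apply: complexP => /=; rewrite RI_cst ?mul0r ?mulr0 //.
  by rewrite mul1r mulVf // gt_eqF ?pi2_gt0.
have n0R : n%:~R != 0 :> R by rewrite intr_eq0.
have [hc hs] := trig_2pi n.
apply: complexP => /=.
  under eq_Rintegral do rewrite /zpow expi_zpow /=.
  by rewrite RI_cos ?mulr0.
under eq_Rintegral do rewrite /zpow expi_zpow /=.
by rewrite RI_sin ?mulr0.
Qed.

Lemma fourier_zpow m n : fourier (zpow m) n = (m == n)%:R.
Proof.
rewrite /fourier /dot -[m == n]subr_eq0 -cintegral_zpow; congr cintegral.
by apply/funext => w; rewrite zpowD -bar_zpow.
Qed.

(** Multiplication by a character only translates the coefficients. All uses of
    analyticity below rest on this. *)
Lemma fourier_shift x m n : fourier (zpow m \* x) n = fourier x (n - m).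
Proof.
rewrite /fourier dot_mul; congr dot; apply/funext => w /=.
by rewrite bar_zpow -[zpow (- m) w * _]zpowD addrC.
Qed.

Lemma fourier_bar x n : L2 x -> fourier (bar x) n = (fourier x (- n))^*.
Proof.
move=> hx; rewrite /fourier /dot -cintegral_conj; last first.
  exact: dot_cintegrable hx (L2_zpow (- n)).
congr cintegral; apply/funext => w; rewrite /bar rmorphM /= conjCK.
by rewrite -/(zpow n w) -/(bar (zpow n) w) bar_zpow.
Qed.

End Exponentials.

(** * Fourier coefficients determine a function *)

Section Uniqueness.
Local Open Scope classical_set_scope.
Local Open Scope ring_scope.
Variable R : realType.
Local Notation C := R[i].
Local Notation mu := (@lebesgue_measure R).
Local Notation Re := (@complex.Re R).
Local Notation Im := (@complex.Im R).
Implicit Types (x : cfun R) (w : circle R) (m : int) (t : R).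
Local Notation RI f := (Rintegral mu (@angles R) f).

(** By Lebesgue differentiation: the primitive of [X] vanishes on the open interval,
    and its derivative is [X] almost everywhere. *)
Lemma ae_eq0_primitive (X : R -> R) : angle_integrable X ->
  (forall b, 0 < b < pi *+ 2 -> RI (fun t => X t * (t <= b)%R%:R) = 0) ->
  {ae mu, forall t, angles t -> X t = 0}.
Proof.
move=> hX X0.
have iX : mu.-integrable setT (EFin \o (X \_ (@angles R))).
  have := (integrable_mkcond (mu := mu) (EFin \o X) (@measurable_angles R)).1 hX.
  by rewrite restrict_EFin.
have iXy (A : set (measurableTypeR R)) : measurable A -> mu.-integrable A (EFin \o (X \_ (@angles R))).
  by move=> mA; apply: (integrableS _ mA _ iX) => //; exact: measurableT.
have lX : locally_integrable setT (X \_ (@angles R)).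
  by apply: integrable_locally => //; exact: measurable_angles.
have F0 (b : R) : 0 < b < pi *+ 2 ->
    Rintegral mu `]-oo, b] (X \_ (@angles R)) = 0.
  move=> hb; rewrite -[RHS](X0 _ hb) [in RHS]Rintegral_mkcond Rintegral_mkcond.
  congr Rintegral; apply/funext => t; rewrite /patch.
  rewrite mem_setE in_itv /=.
  by case: ifP => tb; case: ifP => ta; rewrite ?mulr1 ?mulr0.
(* the primitive of [X] extended by 0 has derivative [X] almost everywhere *)
have := FTC1Ny (fun y => iXy `]-oo, y]%classic (measurable_itv _)) lX.
move=> FTC.
have n0 : {ae mu, forall t, t != 0}.
  exists [set 0]; split; [exact: measurable_set1|exact: lebesgue_measure_set1|].
  by move=> t /= /negP; rewrite negbK => /eqP.
have n1 : {ae mu, forall t, t != pi *+ 2}.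
  exists [set pi *+ 2]; split; [exact: measurable_set1|exact: lebesgue_measure_set1|].
  by move=> t /= /negP; rewrite negbK => /eqP.
move: (ae_sub2 (fun t (a : t != 0) (b : t != pi *+ 2) => conj a b) n0 n1) FTC.
apply: ae_sub2 => t [t0 t1] [dF FE] At.
have Ht : 0 < t < pi *+ 2.
  by move: At; rewrite /angles /= in_itv /= !lt_neqAle eq_sym t0 t1.
have : (X \_ (@angles R)) t = 0.
  rewrite -FE.
  transitivity ((cst 0 : R -> R)^`()%classic t); last by rewrite derive1_cst.
  rewrite !derive1E; apply: near_eq_derive.
  near=> s; apply: F0; apply/andP; split.
    by near: s; apply: lt_nbhsr; case/andP: Ht.
  by near: s; apply: lt_nbhsl; case/andP: Ht.
by rewrite patchE mem_set.
Unshelve. all: end_near. Qed.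

Lemma bernoulli_ineq (z : R) k : -1 <= z -> 1 + k%:R * z <= (1 + z) ^+ k.
Proof.
move=> z1; elim: k => [|k IH]; first by rewrite mul0r addr0 expr0.
rewrite exprS -addn1 natrD.
have h : (1 + z) * (1 + k%:R * z) <= (1 + z) * (1 + z) ^+ k.
  by apply: ler_wpM2l => //; lra.
apply: le_trans h; have := mulr_ge0 (ler0n R k) (sqr_ge0 z); lra.
Qed.

(** Polynomials that decrease on [0, 1] and converge to the indicator of
    [y < 1/2], away from [y = 1/2]. They play the part of a Weierstrass
    approximation, with bounds that follow from Bernoulli's inequality alone. *)
Definition steppoly (n : nat) (y : R) : R := (1 - y ^+ n) ^+ (2 ^ n).

Lemma steppoly_itv (n : nat) (y : R) : 0 <= y <= 1 -> 0 <= steppoly n y <= 1.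
Proof.
case/andP=> y0 y1; have := exprn_ge0 n y0; have := exprn_ile1 n y0 y1 => h1 h0.
by rewrite /steppoly exprn_ge0 ?exprn_ile1 //; lra.
Qed.

(** From 1 >= (1 - y^n)^(2^n) >= 1 - (2 y)^n. *)
Lemma steppoly_cvg1 (y : R) : 0 <= y < 1/2 -> steppoly n y @[n --> \oo] --> (1:R).
Proof.
case/andP=> y0 y1.
apply: (@squeeze_cvgr _ _ _ _ (fun n => 1 - (2 * y) ^+ n) (cst 1)).
- apply: nearW => n; rewrite [X in _ && X](proj2 (andP (steppoly_itv n _))) ?andbT; last by lra.
  have := @bernoulli_ineq (- y ^+ n) (2 ^ n).
  rewrite /steppoly natrX mulrN -exprMn; apply.
  by rewrite lerN2 exprn_ile1 //; lra.
- rewrite -[X in _ --> X]subr0; apply: cvgB; first exact: cvg_cst.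
  by apply: cvg_expr; rewrite ger0_norm; lra.
- exact: cvg_cst.
Qed.

(** From (1 - y^n)^(2^n) (1 + y^n)^(2^n) <= 1 and (1 + y^n)^(2^n) >= (2 y)^n. *)
Lemma steppoly_cvg0 (y : R) : 1/2 < y <= 1 -> steppoly n y @[n --> \oo] --> (0:R).
Proof.
case/andP=> y0 y1.
apply: (@squeeze_cvgr _ _ _ _ (cst 0) (fun n => (2 * y)^-1 ^+ n)).
- apply: nearW => n; rewrite [X in X && _](proj1 (andP (steppoly_itv n _))) /=; last by lra.
  rewrite exprVn -div1r ler_pdivlMr; last by apply: exprn_gt0; lra.
  have yn0 : 0 <= y ^+ n by apply: exprn_ge0; lra.
  have yn1 : y ^+ n <= 1 by apply: exprn_ile1; lra.
  apply: (@le_trans _ _ (steppoly n y * (1 + y ^+ n) ^+ (2 ^ n))).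
    apply: ler_wpM2l; first by rewrite (proj1 (andP (steppoly_itv n _))) //; lra.
    have := @bernoulli_ineq (y ^+ n) (2 ^ n); rewrite natrX -exprMn => h.
    by apply: le_trans (h _); lra.
  rewrite -exprMn; apply: exprn_ile1; nra.
- exact: cvg_cst.
- by apply: cvg_expr; rewrite ger0_norm ?invr_ge0 ?invf_lt1; lra.
Qed.

End Uniqueness.

Section UniquenessFourier.
Local Open Scope classical_set_scope.
Local Open Scope ring_scope.
Variable R : realType.
Local Notation C := R[i].
Local Notation mu := (@lebesgue_measure R).
Local Notation Re := (@complex.Re R).
Local Notation Im := (@complex.Im R).
Implicit Types (x y : cfun R) (w : circle R) (n m : int) (t b : R).
Local Notation RI f := (Rintegral mu (@angles R) f).

Lemma fourierD x y n : L2 x -> L2 y -> fourier (x \+ y) n = fourier x n + fourier y n.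
Proof. by move=> hx hy; apply: dotDl => //; exact: L2_zpow. Qed.

Lemma fourierB x y n : L2 x -> L2 y -> fourier (x \- y) n = fourier x n - fourier y n.
Proof. by move=> hx hy; apply: dotBl => //; exact: L2_zpow. Qed.

Lemma fourierZ (k : C) x n : L2 x -> fourier (k \*o x) n = k * fourier x n.
Proof. by move=> hx; apply: dotZl => //; exact: L2_zpow. Qed.

Lemma fourier_aeq x y n : L2 x -> L2 y -> aeq x y -> fourier x n = fourier y n.
Proof.
by move=> hx hy xy; apply: dot_aeq => //; [exact: L2_zpow|exact: L2_zpow|exact: aeq_refl].
Qed.

(** These functions form a subspace stable under multiplication by characters,
    hence by trigonometric polynomials; the aim is to show that it is zero. *)
Definition nullcoef x := L2 x /\ forall n, fourier x n = 0.

Lemma nullcoefD x y : nullcoef x -> nullcoef y -> nullcoef (x \+ y).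
Proof.
move=> [hx x0] [hy y0]; split; first exact: L2D.
by move=> n; rewrite fourierD // x0 y0 addr0.
Qed.

Lemma nullcoefZ (k : C) x : nullcoef x -> nullcoef (k \*o x).
Proof.
move=> [hx x0]; split; first exact: L2Z.
by move=> n; rewrite fourierZ // x0 mulr0.
Qed.

Lemma nullcoef_zpow m x : nullcoef x -> nullcoef (zpow m \* x).
Proof.
move=> [hx x0]; split; first exact: L2_mul (Linf_zpow R m) hx.
by move=> n; rewrite fourier_shift x0.
Qed.

(** A real trigonometric polynomial with values in [0, 1] that is less than 1/2
    exactly on the arc between the angles 0 and [b]. At the angle [t] it equals
    1/2 - (cos (t - b/2) - cos (b/2)) / 4, which is [arcval b t]. *)
Definition arcpoly b : cfun R := fun w =>
  Complex (1/2 + cos (b / 2) / 4) 0 -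
  Complex (1/8) 0 * (sval (expi (- (b / 2))) * zpow 1 w + (sval (expi (- (b / 2))))^* * zpow (-1) w).

Definition arcval b t : R := 1/2 - sin (t / 2) * sin ((b - t) / 2) / 2.

Lemma arcpolyE b t : arcpoly b (expi t) = Complex (arcval b t) 0.
Proof.
have em1 : zpow (-1) (expi t) = (zpow 1 (expi t))^*.
  by rewrite -[RHS]/(bar (zpow 1) _) bar_zpow.
have h : cos t * cos (b / 2) + sin t * sin (b / 2) = cos (b / 2) + 2 * (sin (t / 2) * sin ((b - t) / 2)).
  rewrite -cosB (_ : t - b / 2 = t / 2 - (b - t) / 2); last by field.
  rewrite [in X in _ = X + _](_ : b / 2 = t / 2 + (b - t) / 2); last by field.
  by rewrite cosB cosD; ring.
rewrite /arcpoly em1 /zpow expr1z /arcval.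
apply: complexP; rewrite !ReImE /= cosN sinN; last by ring.
by move: h; set p := cos t; set q := sin t; set r := cos _; set s := sin _; lra.
Qed.

Lemma nullcoef_arc b x : nullcoef x -> nullcoef (arcpoly b \* x).
Proof.
move=> hx; set a := sval (expi (- (b / 2))).
have -> : arcpoly b \* x = (Complex (1/2 + cos (b / 2) / 4) 0 \*o x) \+
  (((- Complex (1/8) 0 * a) \*o (zpow 1 \* x)) \+ ((- Complex (1/8) 0 * a^* ) \*o (zpow (-1) \* x))).
  by apply/funext => w; rewrite /arcpoly -/a; clearbody a => /=; ring.
apply: nullcoefD; first exact: nullcoefZ.
by apply: nullcoefD; apply: nullcoefZ; apply: nullcoef_zpow.
Qed.

Definition arcstep b (n : nat) : cfun R := fun w => (1 - arcpoly b w ^+ n) ^+ (2 ^ n).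

Lemma nullcoef_arcstep b (n : nat) x : nullcoef x -> nullcoef (arcstep b n \* x).
Proof.
have P (k : nat) z : nullcoef z -> nullcoef ((fun w => arcpoly b w ^+ k) \* z).
  move=> hz; elim: k => [|k IH].
    by move: hz; congr nullcoef; apply/funext => w /=; rewrite mul1r.
  move: (nullcoef_arc b IH); congr nullcoef; apply/funext => w /=.
  by rewrite exprS mulrA.
rewrite /arcstep; elim: (2 ^ n)%N => [|k IH] hx.
  by move: hx; congr nullcoef; apply/funext => w /=; rewrite mul1r.
have h := IH hx; have := nullcoefD h (nullcoefZ (-1) (P n _ h)).
by congr nullcoef; apply/funext => w /=; rewrite exprS; ring.
Qed.

Lemma arcstepE b (n : nat) t : arcstep b n (expi t) = Complex (steppoly n (arcval b t)) 0.
Proof.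
have P (p : R) k : Complex p 0 ^+ k = Complex (p ^+ k) 0.
  elim: k => [//|k IH]; rewrite !exprS IH.
  by apply: complexP; rewrite ReImE /=; ring.
rewrite /arcstep /steppoly arcpolyE P -[RHS]P; congr (_ ^+ _).
by apply: complexP; rewrite !ReImE /= ?subr0.
Qed.

Lemma arcval_itv b t : 0 <= arcval b t <= 1.
Proof.
rewrite /arcval; set p := sin _; set q := sin _.
have : `|p * q| <= 1.
  by rewrite normrM -[1]mulr1 ler_pM ?normr_ge0 // ?ler_norml ?sin_max ?sin_geN1 ?sin_le1.
by rewrite ler_norml => /andP[h1 h2]; apply/andP; split; lra.
Qed.

Lemma arcval_lt b t : 0 < t -> t < b -> b < pi *+ 2 -> arcval b t < 1/2.
Proof.
move=> t0 tb b2.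
have h1 : 0 < sin (t / 2) by apply: sin_gt0_pi; move: b2; rewrite mulr2n; lra.
have h2 : 0 < sin ((b - t) / 2) by apply: sin_gt0_pi; move: b2; rewrite mulr2n; lra.
rewrite /arcval; have := mulr_gt0 h1 h2; lra.
Qed.

Lemma arcval_gt b t : 0 < b -> b < t -> t < pi *+ 2 -> 1/2 < arcval b t.
Proof.
move=> t0 tb b2.
have h1 : 0 < sin (t / 2) by apply: sin_gt0_pi; move: b2; rewrite mulr2n; lra.
have h2 : 0 < sin (- ((b - t) / 2)) by apply: sin_gt0_pi; move: b2; rewrite mulr2n; lra.
rewrite /arcval; have := mulr_gt0 h1 h2; rewrite sinN; lra.
Qed.

Lemma angle_measurable_steppoly b (n : nat) : angle_measurable (fun t => steppoly n (arcval b t)).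
Proof.
have : cmeasurable (arcstep b n).
  have P (z : cfun R) k : cmeasurable z -> cmeasurable (fun w => z w ^+ k).
    move=> hz; elim: k => [|k IH]; first exact: cmeasurable_cst.
    by under eq_fun do rewrite exprS; exact: cmeasurableM.
  have B (z : cfun R) : cmeasurable z -> cmeasurable (fun w => 1 - z w).
    move=> hz; apply: (@cmeasurableD _ (fun=> 1) (fun w => - z w)).
      exact: cmeasurable_cst.
    under eq_fun do rewrite -mulN1r.
    exact: cmeasurableZ.
  apply: (P _ _ _); apply: (B _ _); apply: (P _ _ _).
  have E n' := Linf_meas (Linf_zpow R n').
  have := cmeasurableD (cmeasurable_cst (Complex (1/2 + cos (b / 2) / 4) 0))
    (cmeasurableZ (- Complex (1/8) 0) (cmeasurableD (cmeasurableZ (sval (expi (- (b / 2)))) (E 1)) (cmeasurableZ ((sval (expi (- (b / 2))))^* ) (E (-1))))).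
  by congr cmeasurable; apply/funext => w; rewrite /arcpoly /=; ring.
by case=> h _; move: h; under eq_fun do rewrite arcstepE.
Qed.

(** Dominated convergence: [steppoly n (arcval b t)] tends to the indicator of
    the arc [0, b], except possibly at the angles 0, [b] and 2 pi. *)
Lemma arc_integral0 (X : R -> R) b : 0 < b < pi *+ 2 -> angle_integrable X ->
  (forall n : nat, RI (fun t => steppoly n (arcval b t) * X t) = 0) ->
  RI (fun t => X t * (t <= b)%R%:R) = 0.
Proof.
move=> /andP[b0 b2] hX X0.
have mf (n : nat) : measurable_fun (@angles R) (EFin \o (fun t => steppoly n (arcval b t) * X t)).
  apply/measurable_EFinP; apply: measurable_funM; first exact: angle_measurable_steppoly.
  exact: angle_integrable_meas.
have mg : measurable_fun (@angles R) (EFin \o (fun t => X t * (t <= b)%R%:R)).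
  apply/measurable_EFinP; apply: measurable_funM; first exact: angle_integrable_meas.
  rewrite (_ : (fun t => _) = \1_(`]-oo, b]%classic : set (measurableTypeR R))).
    by apply: measurable_indic; exact: measurable_itv.
  by apply/funext => t; rewrite indicE mem_setE in_itv.
have ne (c : R) : {ae mu, forall t, t != c}.
  exists [set c]; split; [exact: measurable_set1|exact: lebesgue_measure_set1|].
  by move=> t /= /negP; rewrite negbK => /eqP.
have lim : {ae mu, forall t, angles t ->
   (EFin \o (fun t => steppoly n (arcval b t) * X t)) t @[n --> \oo] --> (EFin \o (fun t => X t * (t <= b)%R%:R)) t}.
  move: (ae_sub2 (fun t (p : t != 0) (q : t != pi *+ 2) => conj p q) (ne 0) (ne (pi *+ 2))) (ne b).
  apply: ae_sub2 => t [t0 t1] tb At /=.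
  apply: cvg_EFin; first exact: nearW.
  have /andP[Ht0 Ht1] : 0 < t < pi *+ 2.
    by move: At; rewrite /angles /= in_itv /= !lt_neqAle eq_sym t0 t1.
  rewrite mulrC; apply: cvgMl => /=.
  have /andP[a0 a1] := arcval_itv b t.
  case: (ltgtP t b) tb => // tb _.
    by apply: steppoly_cvg1; rewrite a0 arcval_lt.
  by apply: steppoly_cvg0; rewrite a1 arcval_gt.
have [|//|_ _ L] := @dominated_convergence _ _ _ mu _ (@measurable_angles R) _ _
   (EFin \o (fun t => `|X t|)) mf mg lim.
- by have := integrable_abse hX.
- apply: aeW => t n At /=; rewrite lee_fin normrM.
  have /andP[p0 p1] := steppoly_itv n (arcval_itv b t).
  by rewrite ger0_norm // ler_piMl.
have E : [sequence (\int[mu]_(t in @angles R) (EFin \o (fun t => steppoly n (arcval b t) * X t)%R) t)%E]_n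
    = fun=> 0%E.
  apply/funext => n /=; have /(integrable_fin_num (@measurable_angles R)) : angle_integrable (fun t => steppoly n (arcval b t) * X t).
    apply: (@angle_integrable_le R _ (fun t => `|X t|)); first exact/measurable_EFinP.
      move=> t _; rewrite normrM.
      have /andP[p0 p1] := steppoly_itv n (arcval_itv b t).
      by rewrite ger0_norm // ler_piMl.
    by have := integrable_abse hX.
  by move=> /fineK <-; congr EFin; exact: X0.
rewrite E in L.
rewrite /Rintegral; have -> // := cvg_unique (@ereal_hausdorff R) L (cvg_cst _).
Qed.

(** The integrals of [x] over all arcs vanish. *)
Lemma nullcoef_aeq0 x : nullcoef x -> aeq x (fun=> 0).
Proof.
move=> hx; have [/L2_cintegrable [hR hI] _] := hx.
have Z (b : R) (n : nat) : cintegral (arcstep b n \* x) = 0.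
  have [_ /(_ 0)] := nullcoef_arcstep b n hx.
  rewrite /fourier /dot => <-; congr cintegral; apply/funext => w /=.
  by rewrite expr0z rmorph1 mulr1.
have Rp (p : R) (z : C) : Complex p 0 * z = Complex (p * Re z) (p * Im z).
  by apply: complexP; rewrite ReImE /=; ring.
have ZR (b : R) (n : nat) : RI (fun t => steppoly n (arcval b t) * Re (x (expi t))) = 0.
  have /(congr1 Re) /= := Z b n.
  under eq_Rintegral do rewrite arcstepE Rp /=.
  by move/eqP; rewrite mulf_eq0 invr_eq0 (gt_eqF (@pi2_gt0 R)) => /eqP.
have ZI (b : R) (n : nat) : RI (fun t => steppoly n (arcval b t) * Im (x (expi t))) = 0.
  have /(congr1 Im) /= := Z b n.
  under eq_Rintegral do rewrite arcstepE Rp /=.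
  by move/eqP; rewrite mulf_eq0 invr_eq0 (gt_eqF (@pi2_gt0 R)) => /eqP.
have := ae_eq0_primitive hI (fun b hb => arc_integral0 hb hI (ZI b)).
have := ae_eq0_primitive hR (fun b hb => arc_integral0 hb hR (ZR b)).
by apply: ae_sub2 => t p q At; apply: complexP; [exact: p|exact: q].
Qed.

End UniquenessFourier.

(** * Completeness of L^2 *)

Section Completeness.
Local Open Scope classical_set_scope.
Local Open Scope ring_scope.
Variable R : realType.
Local Notation C := R[i].
Local Notation mu := (@lebesgue_measure R).
Local Notation Re := (@complex.Re R).
Local Notation Im := (@complex.Im R).
Implicit Types (x y z : cfun R) (w : circle R) (T : nat -> cfun R) (t : R).
Local Notation RI f := (Rintegral mu (@angles R) f).

Lemma cvgn_bounded_variation (a : R^nat) (K : R) :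
  (forall n, \sum_(0 <= j < n) `|a j.+1 - a j| <= K) -> cvgn a.
Proof.
move=> aK; have h : cvgn (series (fun j => a j.+1 - a j)).
  apply: normed_cvg; apply: nondecreasing_is_cvgn.
    by apply: nondecreasing_series => n _ _; exact: normr_ge0.
  by exists K => _ [n _ <-]; exact: aK.
have -> : a = (fun n => a 0%N + series (fun j => a j.+1 - a j) n).
  apply/funext; elim=> [|n IH]; first by rewrite /series /= big_geq // addr0.
  by rewrite seriesSr addrA -IH addrC subrK.
by apply: is_cvgD => //; exact: is_cvg_cst.
Qed.

Lemma geo_sum_le n : \sum_(0 <= j < n) (2^-1 : R) ^+ j <= 2.
Proof.
suff -> : \sum_(0 <= j < n) (2^-1 : R) ^+ j = 2 - 2 * 2^-1 ^+ n.
  by rewrite gerBl mulr_ge0 // exprn_ge0 // invr_ge0.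
elim: n => [|n IH]; first by rewrite big_geq // expr0; ring.
by rewrite big_nat_recr //= IH exprS; field.
Qed.

Lemma nrm2E z : L2 z -> (\int[mu]_(t in @angles R) (norm2 z t)%:E = (pi *+ 2 * nrm2 z)%:E)%E.
Proof.
move=> /L2P[_ hz]; rewrite /nrm2 mulVKf ?gt_eqF ?pi2_gt0 //.
by rewrite /Rintegral fineK //; apply: integrable_fin_num hz; exact: measurable_angles.
Qed.

(** The integral of [sum_j 2^j |T_(j+1) - T_j|^2] is at most [2 pi sum_j 2^-j], so
    the sum is finite almost everywhere; as [|a| <= 2^j a^2 + 2^-j], the
    sequence then has bounded variation there. *)
Lemma ae_cvgn T : (forall j, L2 (T j)) ->
  (forall j, nrm2 (T j.+1 \- T j) <= 4^-1 ^+ j) ->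
  {ae mu, forall t, angles t -> cvgn (fun j => Re (T j (expi t))) /\ cvgn (fun j => Im (T j (expi t)))}.
Proof.
move=> TL TC.
(* the weight [2^j] turns the bound [4^-j] on the squares into a summable bound
   on the terms themselves *)
pose D j t : R := 2 ^+ j * norm2 (T j.+1 \- T j) t.
have D0 j t : 0 <= D j t by rewrite mulr_ge0 ?exprn_ge0 ?abs2_ge0.
have dL j : L2 (T j.+1 \- T j) by exact: L2B.
have mD j : measurable_fun (@angles R) (EFin \o D j).
  apply/measurable_EFinP; apply: measurable_funM; first exact: measurable_cst.
  by apply: angle_measurable_norm2; exact: L2_meas.
have ID j : (\int[mu]_(t in @angles R) (EFin \o D j) t <= (pi *+ 2 * 2^-1 ^+ j)%:E)%E.
  have -> : (\int[mu]_(t in @angles R) (EFin \o D j) t = (2 ^+ j)%:E * \int[mu]_(t in @angles R) (norm2 (T j.+1 \- T j) t)%:E)%E.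
    rewrite -ge0_integralZl ?lee_fin ?exprn_ge0 //; first exact: measurable_angles.
      by apply/measurable_EFinP; apply: angle_measurable_norm2; exact: L2_meas.
    by move=> t _; rewrite lee_fin abs2_ge0.
  rewrite nrm2E // -EFinM lee_fin mulrCA ler_wpM2l ?(ltW (@pi2_gt0 R)) //.
  apply: (@le_trans _ _ (2 ^+ j * 4^-1 ^+ j)); first by rewrite ler_wpM2l // exprn_ge0.
  by rewrite -exprMn (_ : 2 * 4^-1 = 2^-1 :> R) //; field.
pose f t := (\sum_(0 <= j <oo) (EFin \o D j) t)%E.
have If : mu.-integrable (@angles R) f.
  apply/integrableP; split.
    have D0' (j : nat) t : angles t -> xpredT j -> (0 <= (EFin \o D j) t)%E.
      by move=> _ _; rewrite lee_fin.
    exact: (@ge0_emeasurable_sum _ _ R (@angles R) (fun j => EFin \o D j) xpredT D0' (fun j _ => mD j)).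
  apply: (@le_lt_trans _ _ (pi *+ 2 * 2)%:E); last exact: ltry.
  have -> : (\int[mu]_(t in @angles R) `|f t| = \int[mu]_(t in @angles R) f t)%E.
    by apply: eq_integral => t _; rewrite gee0_abs //; apply: nneseries_ge0 => j _ _; rewrite lee_fin.
  rewrite integral_nneseries //; last 2 first.
  - exact: measurable_angles.
  - by move=> j t _; rewrite lee_fin.
  apply: lime_le.
    by apply: is_cvg_nneseries => j _ _; apply: (@integral_ge0 _ _ _ mu) => t _; rewrite lee_fin.
  apply: nearW => n; apply: le_trans (lee_sum _ (fun j _ => ID j)) _.
  rewrite sumEFin lee_fin -mulr_sumr ler_wpM2l ?(ltW (@pi2_gt0 R)) //.
  exact: geo_sum_le.
have := integrable_ae (@measurable_angles R) If.
apply: ae_sub => t /[apply] ft.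
have DK n : \sum_(0 <= j < n) D j t <= fine (f t).
  rewrite -lee_fin (fineK ft) -sumEFin.
  by apply: (@nneseries_lim_ge R (fun j => (D j t)%:E) xpredT 0 n) => j _ _; rewrite lee_fin.
have bnd (a : nat -> R) : (forall j, a j ^+ 2 <= norm2 (T j.+1 \- T j) t) ->
    forall n, \sum_(0 <= j < n) `|a j| <= fine (f t) + 2.
  move=> ha n; apply: le_trans (lerD (DK n) (geo_sum_le n)).
  rewrite -big_split /=; apply: ler_sum => j _; rewrite /D.
  have p0 : 0 < 2 ^+ j :> R by apply: exprn_gt0.
  have h := ler_wpM2l (ltW p0) (ha j); apply: le_trans (lerD h (lexx _)).
  have s0 : 0 < 2^-1 ^+ j :> R by apply: exprn_gt0; rewrite invr_gt0.
  have ps : 2 ^+ j * 2^-1 ^+ j = 1 :> R by rewrite -exprMn divff ?expr1n // pnatr_eq0.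
  move: p0 s0 ps; set p := 2 ^+ j; set s := 2^-1 ^+ j => p0 s0 ps.
  have aa : `|a j| ^+ 2 = a j ^+ 2 by rewrite real_normK // num_real.
  rewrite -aa; have n0 := normr_ge0 (a j); move: n0; set b := `|a j| => b0.
  have : 0 <= p * (b - s) ^+ 2 by rewrite mulr_ge0 ?sqr_ge0 // ltW.
  have -> : p * (b - s) ^+ 2 = p * b ^+ 2 - 2 * (p * s) * b + (p * s) * s by ring.
  rewrite ps; lra.
have nE j : norm2 (T j.+1 \- T j) t = (Re (T j.+1 (expi t)) - Re (T j (expi t))) ^+ 2
    + (Im (T j.+1 (expi t)) - Im (T j (expi t))) ^+ 2.
  by rewrite /norm2 /abs2 /= !ReImE.
split; apply: (@cvgn_bounded_variation _ (fine (f t) + 2)); apply: bnd => j; rewrite nE.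
  by rewrite lerDl sqr_ge0.
by rewrite lerDr sqr_ge0.
Qed.

Lemma measurable_einf (F : nat -> R -> \bar R) :
  (forall k, measurable_fun (@angles R : set (measurableTypeR R)) (F k)) ->
  measurable_fun (@angles R : set (measurableTypeR R)) (fun t => limn_einf (F^~ t)).
Proof.
move=> mF; rewrite (_ : (fun t => _) = (fun t => - limn_esup (fun k => - F k t))%E).
  apply: measurableT_comp; first exact: oppe_measurable.
  by apply: measurable_fun_limn_esup => k; apply: measurableT_comp => //; exact: oppe_measurable.
by apply/funext => t; rewrite -limn_einfN; congr limn_einf; apply/funext => k /=; rewrite oppeK.
Qed.

Lemma limn_einf_le (u : (\bar R)^nat) (j : nat) (c : \bar R) :
  (forall k, (j <= k)%N -> (u k <= c)%E) -> (limn_einf u <= c)%E.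
Proof.
move=> uc; rewrite limn_einf_lim; apply: lime_le; first exact: is_cvg_einfs.
apply: nearW => n; apply: le_trans (uc (maxn n j) (leq_maxr _ _)).
by apply: ereal_inf_lbound; exists (maxn n j) => //=; exact: leq_maxl.
Qed.

(** The limit exists almost everywhere by [ae_cvgn], and Fatou's lemma gives both
    that it lies in [L^2] and the rate of convergence. It is defined with a limit
    superior, which is measurable whether or not the sequence converges. *)
Lemma L2_limit T : (forall j, L2 (T j)) ->
  (forall j k, (j <= k)%N -> nrm2 (T k \- T j) <= 4^-1 ^+ j) ->
  exists2 y, L2 y & forall j, nrm2 (y \- T j) <= 4^-1 ^+ j.
Proof.
move=> TL TC.
pose y : cfun R := fun w => Complex (fine (limn_esup (fun j => (Re (T j w))%:E)))
  (fine (limn_esup (fun j => (Im (T j w))%:E))).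
have TM j := L2_meas (TL j).
have my : cmeasurable y.
  split; apply: measurableT_comp => /=; try exact: fine_measurable;
    apply: measurable_fun_limn_esup => j; apply/measurable_EFinP; case: (TM j) => //.
have ycv : {ae mu, forall t, angles t ->
    ((fun j => Re (T j (expi t))) @ \oo --> Re (y (expi t))) /\
    ((fun j => Im (T j (expi t))) @ \oo --> Im (y (expi t)))}.
  have h (a : R^nat) : cvgn a -> a @ \oo --> fine (limn_esup (fun j => (a j)%:E)).
    move=> ca; have ca' : (fun j => (a j)%:E) @ \oo --> (limn a)%:E.
      by apply: cvg_EFin => //; exact: nearW.
    by rewrite (cvg_limn_einf_sup ca').2.
  move: (ae_cvgn TL (fun j => TC _ _ (leqnSn j))); apply: ae_sub => t k At.
  by have [/h ? /h ?] := k At.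
have bound j : (\int[mu]_(t in @angles R) (norm2 (y \- T j) t)%:E <= (pi *+ 2 * 4^-1 ^+ j)%:E)%E.
  pose F (k : nat) (t : R) := (norm2 (T k \- T j) t)%:E.
  have mF k : measurable_fun (@angles R : set (measurableTypeR R)) (F k).
    by apply/measurable_EFinP; apply: angle_measurable_norm2; apply: L2_meas; exact: L2B.
  have -> : (\int[mu]_(t in @angles R) (norm2 (y \- T j) t)%:E = \int[mu]_(t in @angles R) limn_einf (F^~ t))%E.
    apply: ae_eq_integral; first exact: measurable_angles.
    - apply/measurable_EFinP; apply: angle_measurable_norm2; rewrite cfunBE.
      by apply: cmeasurableD => //; apply: cmeasurableZ.
    - exact: measurable_einf.
    move: ycv; apply: ae_sub => t h At; have [kR kI] := h At.
    suff L : (F^~ t) @ \oo --> (norm2 (y \- T j) t)%:E by rewrite (cvg_limn_einf_sup L).1.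
    apply: cvg_EFin; first exact: nearW.
    have nE (z : cfun R) : norm2 (z \- T j) t = (Re (z (expi t)) - Re (T j (expi t))) ^+ 2
        + (Im (z (expi t)) - Im (T j (expi t))) ^+ 2 by rewrite /norm2 /abs2 /= !ReImE.
    rewrite nE [X in X @ _ --> _](_ : _ = fun k => (Re (T k (expi t)) - Re (T j (expi t))) ^+ 2
        + (Im (T k (expi t)) - Im (T j (expi t))) ^+ 2); last first.
      by apply/funext => i; rewrite /F /= nE.
    have sq (a : R^nat) (l c : R) : a @ \oo --> l -> (fun k => (a k - c) ^+ 2) @ \oo --> (l - c) ^+ 2.
      move=> al; rewrite expr2; under eq_fun do rewrite expr2.
      by apply: cvgM; apply: cvgB => //; exact: cvg_cst.
    by apply: cvgD; apply: sq.
  apply: le_trans (fatou mu (@measurable_angles R) mF _) _.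
    by move=> k t _; rewrite lee_fin abs2_ge0.
  apply: (@limn_einf_le _ j) => k jk; rewrite nrm2E; last exact: L2B.
  by rewrite lee_fin ler_wpM2l ?(ltW (@pi2_gt0 R)) ?TC.
have yTL j : L2 (y \- T j).
  have m : cmeasurable (y \- T j).
    by rewrite cfunBE; apply: cmeasurableD => //; apply: cmeasurableZ.
  apply/L2P; split=> //; apply/integrableP; split.
    by apply/measurable_EFinP; exact: angle_measurable_norm2.
  have -> : (\int[mu]_(t in @angles R) `|(EFin \o norm2 (y \- T j)%R) t| =
    \int[mu]_(t in @angles R) (norm2 (y \- T j) t)%:E)%E.
    by apply: eq_integral => t _; rewrite /= ger0_norm ?abs2_ge0.
  exact: le_lt_trans (bound j) (ltry _).
exists y.
  have := L2D (yTL 0%N) (TL 0%N); congr L2; apply/funext => w /=; exact: subrK.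
move=> j; have := bound j; rewrite nrm2E // lee_fin.
by rewrite ler_pM2l ?pi2_gt0.
Qed.

End Completeness.

(** * The Riesz projection *)

Section Projection.
Local Open Scope classical_set_scope.
Local Open Scope ring_scope.
Variable R : realType.
Local Notation C := R[i].
Local Notation Re := (@complex.Re R).
Local Notation Im := (@complex.Im R).
Implicit Types (x y z h : cfun R) (w : circle R) (c : nat -> C) (n : int).

Lemma L2_zpowR n : L2 (zpow n : cfun R). Proof. exact: L2_zpow. Qed.
Hint Resolve L2_zpowR : core.

(** Pythagoras, for the removal of one Fourier term. Bessel's inequality and the
    norms of the partial sums both follow from it by induction. *)
Lemma nrm2_sub y n : L2 y ->
  nrm2 (y \- (fourier y n \*o zpow n)) = nrm2 y - abs2 (fourier y n).
Proof.
move=> hy; have ee : dot (zpow n : cfun R) (zpow n) = 1 by rewrite [LHS]fourier_zpow eqxx.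
have hce : L2 (fourier y n \*o zpow n) by exact: L2Z.
have : dot (y \- (fourier y n \*o zpow n)) (y \- (fourier y n \*o zpow n)) =
    dot y y - fourier y n * (fourier y n)^*.
  rewrite dotBl ?dotBr ?dotZl ?dotZr //; try exact: L2B.
  rewrite (dotC hy (L2_zpowR n)) ee -/(fourier y n).
  by ring.
by rewrite !dotxx abs2E => /(congr1 Re); rewrite ReD ReN.
Qed.

Lemma abs2_fourier_le y n : L2 y -> abs2 (fourier y n) <= nrm2 y.
Proof. by move=> hy; rewrite -subr_ge0 -nrm2_sub // nrm2_ge0. Qed.

Definition trigsum c (N : nat) : cfun R := fun w => \sum_(k < N) c k * zpow k w.

Lemma trigsumS c N : trigsum c N.+1 = trigsum c N \+ (c N \*o zpow N).
Proof. by apply/funext => w; rewrite /trigsum big_ord_recr. Qed.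

Lemma trigsum0 c : trigsum c 0 = fun=> 0.
Proof. by apply/funext => w; rewrite /trigsum big_ord0. Qed.

Lemma L2_trigsum c N : L2 (trigsum c N).
Proof.
elim: N => [|N IH]; first by rewrite trigsum0; exact: L2_cst.
by rewrite trigsumS; apply: L2D => //; exact: L2Z.
Qed.
Hint Resolve L2_trigsum : core.

Lemma zero_cfunE : (fun=> 0 : C) = 0 \*o (zpow 0 : cfun R).
Proof. by apply/funext => w /=; rewrite mul0r. Qed.

Lemma dot0l y : L2 y -> dot (fun=> 0) y = 0 :> C.
Proof. by move=> hy; rewrite zero_cfunE dotZl // mul0r. Qed.

Lemma fourier_zero n : fourier (fun=> 0 : C) n = 0 :> C.
Proof. by apply: dot0l; exact: L2_zpow. Qed.

Lemma dot_trigsum z c N : L2 z -> (forall k : nat, fourier z k = 0) -> dot z (trigsum c N) = 0.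
Proof.
move=> hz z0; elim: N => [|N IH]; first by rewrite trigsum0 zero_cfunE dotZr // rmorph0 mul0r.
have hN : L2 (c N \*o (zpow N : cfun R)) by exact: L2Z.
by rewrite trigsumS dotDr // IH dotZr // [dot z (zpow N)]z0 mulr0 addr0.
Qed.

Lemma fourier_trigsum c N n :
  fourier (trigsum c N) n = \sum_(k < N) c k * (k == n :> int)%:R.
Proof.
elim: N => [|N IH]; first by rewrite trigsum0 fourier_zero big_ord0.
by rewrite trigsumS fourierD ?fourierZ ?IH ?fourier_zpow ?big_ord_recr //; exact: L2Z.
Qed.

Lemma fourier_trigsum_nat c N (k : nat) : fourier (trigsum c N) k = if (k < N)%N then c k else 0.
Proof.
rewrite fourier_trigsum; case: ltnP => kN.
  rewrite (bigD1 (Ordinal kN)) //= eqxx mulr1 big1 ?addr0 // => i.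
  by rewrite eqz_nat -val_eqE /= => /negPf ->; rewrite mulr0.
rewrite big1 // => i _; rewrite eqz_nat; case: eqP => [ik|]; rewrite ?mulr0 //.
by move: (ltn_ord i); rewrite ik ltnNge kN.
Qed.

Lemma fourier_trigsum_neg c N n : n < 0 -> fourier (trigsum c N) n = 0.
Proof.
move=> n0; rewrite fourier_trigsum big1 // => i _; case: eqP => [ik|]; rewrite ?mulr0 //.
by move: n0; rewrite -ik.
Qed.

Definition sqsum c N : R := \sum_(0 <= k < N) abs2 (c k).

Lemma nrm2_trigsumB c N M : (N <= M)%N -> nrm2 (trigsum c M \- trigsum c N) = sqsum c M - sqsum c N.
Proof.
move=> /subnK <-; elim: (M - N)%N => [|k IH].
  rewrite add0n subrr /nrm2 (_ : norm2 _ = cst 0) ?RI_cst ?mul0r ?mulr0 //.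
  by apply/funext => t; rewrite /norm2 /= subrr /abs2 /= expr0n addr0.
have hy : L2 (trigsum c (k.+1 + N) \- trigsum c N) by exact: L2B.
have fy : fourier (trigsum c (k.+1 + N) \- trigsum c N) (k + N)%N = c (k + N)%N.
  by rewrite fourierB // !fourier_trigsum_nat addSn ltnSn ltnNge leq_addl subr0.
have := nrm2_sub (k + N)%N hy; rewrite fy => h.
rewrite [X in nrm2 X](_ : _ = trigsum c (k + N) \- trigsum c N) in h; last first.
  by apply/funext => w; rewrite addSn trigsumS /=; ring.
rewrite IH in h; rewrite /sqsum [in RHS]addSn big_nat_recr //= -!/(sqsum _ _).
lra.
Qed.

Lemma bessel x N : L2 x -> sqsum (fun k => fourier x k) N <= nrm2 x.
Proof.
set c := (fun k : nat => _) => hx.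
suff h : nrm2 (x \- trigsum c N) = nrm2 x - sqsum c N.
  by rewrite -subr_ge0 -h nrm2_ge0.
elim: N => [|N IH].
  rewrite /sqsum big_geq // subr0; congr nrm2; apply/funext => w.
  by rewrite trigsum0 /= subr0.
have hy : L2 (x \- trigsum c N) by exact: L2B.
have fy : fourier (x \- trigsum c N) N = c N.
  by rewrite fourierB // fourier_trigsum_nat ltnn subr0.
have := nrm2_sub N hy; rewrite fy IH /sqsum big_nat_recr //= -/(sqsum c N) => h.
rewrite opprD addrA -h; congr nrm2; apply/funext => w.
by rewrite trigsumS /= opprD addrA.
Qed.

Lemma le_geo_eq0 (a K : R) : 0 <= a -> (forall j : nat, a <= K * 4^-1 ^+ j) -> a = 0.
Proof.
move=> a0 aK; apply/eqP; rewrite eq_le a0 andbT.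
have L : (fun j : nat => K * 4^-1 ^+ j) @ \oo --> K * 0.
  apply: cvgMr; apply: cvg_expr; rewrite ger0_norm ?invr_ge0 //; lra.
rewrite -(mulr0 K); apply: (ler_cvg_to (cvg_cst a) L).
by apply: nearW => j; exact: aK.
Qed.

(** Partial sums along indices [phi j] beyond which the tail of the sum of the
    squared coefficients is at most [4^-j] satisfy the hypothesis of [L2_limit].
    The sums are part of the conclusion because they are used again to prove
    orthogonality. *)
Lemma riesz_fischer x : L2 x -> exists (y : cfun R) (phi : nat -> nat),
  [/\ L2 y, forall n, fourier y n = if 0 <= n then fourier x n else 0 &
    forall j, nrm2 (y \- trigsum (fun k => fourier x k) (phi j)) <= 4^-1 ^+ j].
Proof.
move=> hx; set c := (fun k : nat => fourier x k).
have nd : {homo sqsum c : n m / (n <= m)%N >-> n <= m}.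
  by move=> N M NM; rewrite -subr_ge0 -nrm2_trigsumB // nrm2_ge0.
have ub : has_ubound (range (sqsum c)).
  by exists (nrm2 x) => _ [N _ <-]; exact: bessel.
have cv := nondecreasing_is_cvgn nd ub.
have leL N : sqsum c N <= limn (sqsum c) by exact: nondecreasing_cvgn_le.
have /choice[psi hpsi] (j : nat) : exists N, forall M, (N <= M)%N -> limn (sqsum c) - sqsum c M <= 4^-1 ^+ j.
  have e0 : 0 < 4^-1 ^+ j :> R by rewrite exprn_gt0 // invr_gt0.
  have := cv; move=> /cvgrPdist_le /(_ _ e0) [N _ h].
  by exists N => M NM; apply: le_trans (ler_norm _) (h M NM).
(* [phi] dominates [psi], is monotone and tends to infinity *)
pose phi j := (\sum_(i < j.+1) (psi i).+1)%N.
have phi_psi j : (psi j <= phi j)%N by rewrite /phi big_ord_recr /= -ltnS ltnS addnS ltnW // ltnS leq_addl.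
have phi_j j : (j <= phi j)%N.
  elim: j => [//|j IH]; rewrite /phi big_ord_recr /= -/(phi j) addnS ltnS.
  by apply: leq_trans IH _; exact: leq_addr.
have phi_nd j k : (j <= k)%N -> (phi j <= phi k)%N.
  move=> /subnK <-; elim: (k - j)%N => [//|i IH].
  by apply: leq_trans IH _; rewrite addSn [phi _.+1]/phi big_ord_recr /= leq_addr.
have [|j k jk|y yL yT] := @L2_limit R (fun j => trigsum c (phi j)); first by [].
  rewrite nrm2_trigsumB ?phi_nd //; apply: le_trans (hpsi j _ (phi_psi j)).
  by rewrite lerD2r leL.
exists y, phi; split=> // n.
have B j : abs2 (fourier y n - fourier (trigsum c (phi j)) n) <= 4^-1 ^+ j.
  by rewrite -fourierB //; apply: le_trans (yT j); apply: abs2_fourier_le; exact: L2B.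
apply/eqP; rewrite -subr_eq0; apply/eqP/abs2_eq0.
case: n B => n B.
  apply: (@le_geo_eq0 _ (4^-1 ^+ n.+1)); first exact: abs2_ge0.
  move=> j; rewrite -exprD; apply: le_trans (B (n.+1 + j)%N).
  rewrite fourier_trigsum_nat ifT //.
  by apply: leq_trans (phi_j _); rewrite leq_addr.
apply: (@le_geo_eq0 _ 1); first exact: abs2_ge0.
by move=> j; rewrite mul1r; have := B j; rewrite fourier_trigsum_neg.
Qed.

Lemma cauchy_schwarz x y : L2 x -> L2 y -> abs2 (dot x y) <= nrm2 x * nrm2 y.
Proof.
move=> hx hy; set d := dot x y; set N := nrm2 y.
have [/(nrm2_eq0 hy) y0|N0] := eqVneq (nrm2 y) 0.
  have -> : d = 0.
    rewrite /d (@dot_aeq R x x y (0 \*o y)) ?dotZr ?rmorph0 ?mul0r //; [exact: L2Z|exact: aeq_refl|].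
    by move: y0; apply: ae_sub => t k At /=; rewrite mul0r k.
  by rewrite /abs2 /= expr0n addr0 mulr_ge0 // nrm2_ge0.
have Np : 0 < N by rewrite lt_neqAle eq_sym N0 nrm2_ge0.
(* [N x - d y] is [N] times the component of [x] orthogonal to [y] *)
have := nrm2_ge0 ((Complex N 0 \*o x) \- (d \*o y)).
have : dot ((Complex N 0 \*o x) \- (d \*o y)) ((Complex N 0 \*o x) \- (d \*o y)) =
    Complex N 0 * (Complex N 0 * Complex (nrm2 x) 0 - d * d^* ).
  have hnx : L2 (Complex N 0 \*o x) by exact: L2Z.
  have hdy : L2 (d \*o y) by exact: L2Z.
  rewrite dotBl ?dotBr ?dotZl ?dotZr //; try exact: L2B.
  rewrite (dotC hx hy) -/d !dotxx -/N.
  have -> : (Complex N 0)^* = Complex N 0 by apply: complexP; rewrite ReImE //= oppr0.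
  by ring.
rewrite dotxx abs2E => /(congr1 Re); rewrite !ReImE /= !mul0r !subr0 => -> .
rewrite pmulr_rge0 // => h; rewrite mulrC; lra.
Qed.

Lemma H2_zpow (k : nat) : H2 (zpow k : cfun R).
Proof.
split=> // n n0; rewrite fourier_zpow; case: eqP => // kn.
by move: n0; rewrite -kn.
Qed.

(** Half of Parseval's identity. By uniqueness [h] is the [L^2] limit of the partial
    sums of its own series, and these are orthogonal to [z]. *)
Lemma orth_H2 z h : L2 z -> (forall k : nat, fourier z k = 0) -> H2 h -> dot z h = 0.
Proof.
move=> hz z0 [hh h0]; have [y [phi [yL yf yT]]] := riesz_fischer hh.
have yh : aeq h y.
  have : nullcoef (h \- y).
    split; first exact: L2B.
    move=> n; rewrite fourierB // yf; case: ifPn => n0; rewrite ?subrr // subr0 h0 //.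
    by rewrite ltNge.
  by move=> /nullcoef_aeq0; apply: ae_sub => t k At; apply/eqP; rewrite -subr_eq0; apply/eqP; exact: k.
rewrite (dot_aeq hz hz hh yL (aeq_refl _) yh); apply: abs2_eq0.
apply: (@le_geo_eq0 _ (nrm2 z)); first exact: abs2_ge0.
move=> j; have hyp : L2 (y \- trigsum (fun k => fourier h k) (phi j)) by exact: L2B.
have -> : dot z y = dot z (y \- trigsum (fun k => fourier h k) (phi j)).
  by rewrite dotBr // dot_trigsum // subr0.
apply: le_trans (cauchy_schwarz hz hyp) _.
by rewrite ler_wpM2l ?nrm2_ge0.
Qed.

(** The defining property of the projection. The chosen element exists by
    [riesz_fischer]. *)
Lemma PplusP x : L2 x -> H2 (Pplus x) /\ forall h, H2 h -> dot (x \- Pplus x) h = 0.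
Proof.
move=> hx; rewrite /Pplus; apply: (@xgetPex _ _ [set y | H2 y /\ forall h, H2 h -> dot (x \- y) h = 0]).
have [y [phi [yL yf _]]] := riesz_fischer hx.
exists y; split; first by split=> // n n0; rewrite yf leNgt n0.
move=> h hh; apply: orth_H2 => //; first exact: L2B.
by move=> k; rewrite fourierB // yf subrr.
Qed.

Lemma L2_Pplus x : L2 x -> L2 (Pplus x).
Proof. by move=> /PplusP[[]]. Qed.

Lemma L2_Pminus x : L2 x -> L2 (Pminus x).
Proof. by move=> hx; apply: L2B => //; exact: L2_Pplus. Qed.

(** The coefficients describe [Pplus x] completely, so that from here on the
    projections are handled through their coefficients. *)
Lemma fourier_Pplus x n : L2 x -> fourier (Pplus x) n = if 0 <= n then fourier x n else 0.
Proof.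
move=> hx; have [[PL P0] O] := PplusP hx.
case: n => n; last by rewrite P0.
apply/esym/eqP; rewrite /= -subr_eq0 -fourierB //; apply/eqP.
by apply: O; exact: H2_zpow.
Qed.

Lemma fourier_Pminus x n : L2 x -> fourier (Pminus x) n = if 0 <= n then 0 else fourier x n.
Proof.
move=> hx; rewrite /Pminus fourierB ?fourier_Pplus //; last exact: L2_Pplus.
by case: ifP => _; rewrite ?subrr ?subr0.
Qed.

Lemma Pplus_Pminus x : Pplus x \+ Pminus x = x.
Proof. by apply/funext => w; rewrite /Pminus /= addrC subrK. Qed.

End Projection.

(** * Analytic and coanalytic functions *)

Section Coefficients.
Local Open Scope classical_set_scope.
Local Open Scope ring_scope.
Variable R : realType.
Local Notation C := R[i].
Local Notation e := (@zpow R).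
Implicit Types (x y z a b f g u v : cfun R) (w : circle R) (n i j : int) (k l : C).

Lemma mulfC x y : x \* y = y \* x.
Proof. by apply/funext => w /=; rewrite mulrC. Qed.

Lemma mulfZ k x y : x \* (k \*o y) = k \*o (x \* y).
Proof. by apply/funext => w /=; ring. Qed.

(** For bounded [x], this is membership in [H^oo]. *)
Definition analytic x := forall n, n < 0 -> fourier x n = 0.
(** For bounded [x], this says that the conjugate of [x] lies in [H^oo]. *)
Definition coanalytic x := forall n, 0 < n -> fourier x n = 0.

Lemma barK x : bar (bar x) = x.
Proof. by apply/funext => w; rewrite /bar conjCK. Qed.
Lemma barM x y : bar x \* bar y = bar (x \* y).
Proof. by apply/funext => w; rewrite /bar /= rmorphM. Qed.
Lemma barB x y : bar x \- bar y = bar (x \- y).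
Proof. by apply/funext => w; rewrite /bar /= rmorphB. Qed.
Lemma barD x y : bar x \+ bar y = bar (x \+ y).
Proof. by apply/funext => w; rewrite /bar /= rmorphD. Qed.
Lemma barZ k x : k^* \*o bar x = bar (k \*o x).
Proof. by apply/funext => w; rewrite /bar /= rmorphM. Qed.
Definition barE := (barM, barB, barD, barZ).

Lemma Hinf_analyticI x : Linf x -> analytic x -> Hinf x.
Proof. by move=> hx h; split=> //; split=> //; exact: Linf_L2. Qed.

Lemma Hinf_coanalyticI x : Linf x -> coanalytic x -> Hinf (bar x).
Proof.
move=> hx h; apply: Hinf_analyticI; first exact: Linf_bar.
by move=> n n0; rewrite fourier_bar ?h ?rmorph0 ?oppr_gt0 //; exact: Linf_L2.
Qed.

Lemma Hinf_analytic x : Hinf x -> analytic x. Proof. by case=> _ []. Qed.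

Lemma Hinf_coanalytic x : Hinf (bar x) -> coanalytic x.
Proof.
move=> [hx [_ h]] n n0; rewrite -(barK x) fourier_bar; last exact: Linf_L2.
by rewrite h ?rmorph0 // oppr_lt0.
Qed.

Lemma fourier_cst k n : fourier (fun=> k : C) n = k * (n == 0)%:R :> C.
Proof.
rewrite (_ : (fun=> k) = k \*o e 0); last first.
  by apply/funext => w; rewrite /zpow /= expr0z mulr1.
by rewrite fourierZ ?fourier_zpow 1?eq_sym //; exact: L2_zpow.
Qed.

Lemma constant_funP x : L2 x -> constant_fun x <-> analytic x /\ coanalytic x.
Proof.
move=> hx; split=> [[c xc]|[ax cx]].
  have F n : fourier x n = c * (n == 0)%:R.
    by rewrite -fourier_cst; apply: fourier_aeq => //; exact: L2_cst.
  by split=> n n0; rewrite F; case: eqP n0 => [->|]; rewrite ?ltxx ?mulr0.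
exists (fourier x 0).
have : nullcoef (x \- (fun=> fourier x 0)).
  split=> [|n]; first by apply: L2B => //; exact: L2_cst.
  rewrite fourierB //; last exact: L2_cst.
  rewrite fourier_cst; case: (ltgtP n 0) => [n0|n0|->]; rewrite ?mulr0 ?mulr1 ?subrr //.
    by rewrite ax // subrr.
  by rewrite cx // subrr.
by move=> /nullcoef_aeq0; apply: ae_sub => t h At; apply/eqP; rewrite -subr_eq0; apply/eqP; exact: h.
Qed.

(** The coefficients of [x y] at [n < 0] are inner products of [x] with
    [conj(y) z^n], whose coefficients at [k >= 0] vanish; [orth_H2] applies. *)
Lemma analytic_mul x y : Linf x -> Linf y -> analytic x -> analytic y -> analytic (x \* y).
Proof.
move=> hx hy ax ay n n0.
have yL : L2 (bar y \* e n) by apply: L2_mul (Linf_bar hy) (L2_zpow R n).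
have xL := Linf_L2 hx.
have -> : fourier (x \* y) n = dot x (bar y \* e n).
  by rewrite mulfC; exact: dot_mul.
rewrite (dotC yL xL) orth_H2 ?rmorph0 //.
move=> k; rewrite mulfC fourier_shift fourier_bar ?ay ?rmorph0 //; last exact: Linf_L2.
by rewrite opprB subr_lt0 (lt_le_trans n0).
Qed.

Lemma coanalytic_mul x y : Linf x -> Linf y -> coanalytic x -> coanalytic y -> coanalytic (x \* y).
Proof.
move=> hx hy cx cy; apply: Hinf_coanalytic; rewrite -barM; apply: Hinf_analyticI.
  by apply: LinfM; apply: Linf_bar.
by apply: analytic_mul; do ?[exact: Linf_bar]; apply: Hinf_analytic; exact: Hinf_coanalyticI.
Qed.

Lemma aeq_fourier x y : L2 x -> L2 y -> (forall n, fourier x n = fourier y n) -> aeq x y.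
Proof.
move=> hx hy xy; have : nullcoef (x \- y).
  by split=> [|n]; [exact: L2B|rewrite fourierB // xy subrr].
by move=> /nullcoef_aeq0; apply: ae_sub => t h At; apply/eqP; rewrite -subr_eq0; apply/eqP; exact: h.
Qed.

Lemma dot_fourier_r x y z : L2 x -> L2 y -> L2 z -> (forall n, fourier y n = fourier z n) -> dot x y = dot x z.
Proof.
by move=> hx hy hz yz; apply: dot_aeq => //; [exact: aeq_refl|exact: aeq_fourier].
Qed.

Lemma dot_fourier_l x y z : L2 x -> L2 y -> L2 z -> (forall n, fourier y n = fourier z n) -> dot y x = dot z x.
Proof.
by move=> hx hy hz yz; apply: dot_aeq => //; [exact: aeq_fourier|exact: aeq_refl].
Qed.

End Coefficients.

HB.lock Definition dot_plus (R : realType) (x y : cfun R) : R[i] := dot (Pplus x) (Pplus y).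
HB.lock Definition dot_minus (R : realType) (x y : cfun R) : R[i] := dot (Pminus x) (Pminus y).

(** * Matrix entries of a product of two operators *)

Section Operators.
Local Open Scope classical_set_scope.
Local Open Scope ring_scope.
Variable R : realType.
Local Notation C := R[i].
Local Notation e := (@zpow R).
Implicit Types (x y z a b f g u v : cfun R) (w : circle R) (n i j : int) (k l : C).

Lemma dot_Pminus_Pplus x y : L2 x -> L2 y -> dot (Pminus x) (Pplus y) = 0.
Proof.
move=> hx hy; apply: orth_H2; first exact: L2_Pminus.
  by move=> k; rewrite fourier_Pminus.
by case: (PplusP hy).
Qed.

Lemma dot_Pplus_Pminus x y : L2 x -> L2 y -> dot (Pplus x) (Pminus y) = 0.
Proof.
move=> hx hy; have hp := L2_Pplus hx; have hm := L2_Pminus hy.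
by rewrite (dotC hm hp) dot_Pminus_Pplus ?rmorph0.
Qed.

Lemma dot_plusE x y : L2 x -> L2 y -> dot_plus x y = dot (Pplus x) y.
Proof.
move=> hx hy; rewrite dot_plus.unlock -[in RHS](Pplus_Pminus y) dotDr ?dot_Pplus_Pminus ?addr0 //.
- exact: L2_Pplus.
- exact: L2_Pplus.
- exact: L2_Pminus.
Qed.

Lemma dot_minusE x y : L2 x -> L2 y -> dot_minus x y = dot (Pminus x) y.
Proof.
move=> hx hy; rewrite dot_minus.unlock -[in RHS](Pplus_Pminus y) dotDr ?dot_Pminus_Pplus ?add0r //.
- exact: L2_Pminus.
- exact: L2_Pplus.
- exact: L2_Pminus.
Qed.

Lemma dot_plusC x y : L2 x -> L2 y -> dot_plus y x = (dot_plus x y)^*.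
Proof. by move=> hx hy; rewrite dot_plus.unlock; apply: dotC; exact: L2_Pplus. Qed.

Lemma dot_minusC x y : L2 x -> L2 y -> dot_minus y x = (dot_minus x y)^*.
Proof. by move=> hx hy; rewrite dot_minus.unlock; apply: dotC; exact: L2_Pminus. Qed.

Lemma dot_plusEr x y : L2 x -> L2 y -> dot_plus x y = dot x (Pplus y).
Proof.
move=> hx hy; rewrite (dot_plusC hy hx) dot_plusE //.
by rewrite -dotC //; exact: L2_Pplus.
Qed.

Lemma dot_minusEr x y : L2 x -> L2 y -> dot_minus x y = dot x (Pminus y).
Proof.
move=> hx hy; rewrite (dot_minusC hy hx) dot_minusE //.
by rewrite -dotC //; exact: L2_Pminus.
Qed.

(** The inner product splits into the contributions of the two ranges. This is the
    step by which two blocks of a product combine into one Fourier coefficient. *)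
Lemma dot_plus_minus x y : L2 x -> L2 y -> dot x y = dot_plus x y + dot_minus x y.
Proof.
move=> hx hy; rewrite dot_plusE // dot_minusE // -dotDl ?Pplus_Pminus //.
- exact: L2_Pplus.
- exact: L2_Pminus.
Qed.

Lemma dot_plusBl x y z : L2 x -> L2 y -> L2 z -> dot_plus (x \- y) z = dot_plus x z - dot_plus y z.
Proof.
move=> hx hy hz; rewrite !dot_plusEr //; last exact: L2B.
by rewrite dotBl //; exact: L2_Pplus.
Qed.
Lemma dot_minusBl x y z : L2 x -> L2 y -> L2 z -> dot_minus (x \- y) z = dot_minus x z - dot_minus y z.
Proof.
move=> hx hy hz; rewrite !dot_minusEr //; last exact: L2B.
by rewrite dotBl //; exact: L2_Pminus.
Qed.
Lemma dot_plusZl k x z : L2 x -> L2 z -> dot_plus (k \*o x) z = k * dot_plus x z.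
Proof.
move=> hx hz; rewrite !dot_plusEr //; last exact: L2Z.
by rewrite dotZl //; exact: L2_Pplus.
Qed.
Lemma dot_minusZl k x z : L2 x -> L2 z -> dot_minus (k \*o x) z = k * dot_minus x z.
Proof.
move=> hx hz; rewrite !dot_minusEr //; last exact: L2Z.
by rewrite dotZl //; exact: L2_Pminus.
Qed.

Lemma dot_plus_eq0 x y : L2 x -> L2 y -> (forall n, 0 <= n -> fourier x n = 0) -> dot_plus x y = 0.
Proof.
move=> hx hy x0; have hp := L2_Pplus hy.
rewrite dot_plus.unlock -[RHS](dot0l hp); apply: (dot_fourier_l hp (L2_Pplus hx) (L2_cst _)) => n.
rewrite fourier_Pplus // fourier_zero.
by case: ifP => // /x0.
Qed.

Lemma dot_minus_eq0 x y : L2 x -> L2 y -> analytic x -> dot_minus x y = 0.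
Proof.
move=> hx hy x0; have hp := L2_Pminus hy.
rewrite dot_minus.unlock -[RHS](dot0l hp); apply: (dot_fourier_l hp (L2_Pminus hx) (L2_cst _)) => n.
rewrite fourier_Pminus // fourier_zero.
by case: ifPn => //; rewrite -ltNge => /x0.
Qed.

Lemma L2_cauchy f u g v x : Linf f -> Linf u -> Linf g -> Linf v -> L2 x ->
  L2 (cauchy_op f u g v x).
Proof.
move=> hf hu hg hv hx; have hp := L2_Pplus hx; have hm := L2_Pminus hx.
apply: L2D; last by apply: L2_Pminus; exact: L2_mul.
apply: L2D; last by apply: L2_Pplus; exact: L2_mul.
apply: L2D; first by apply: L2_Pplus; exact: L2_mul.
by apply: L2_Pminus; exact: L2_mul.
Qed.

Lemma dot_cauchy f u g v x y : Linf f -> Linf u -> Linf g -> Linf v -> L2 x -> L2 y ->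
  dot (cauchy_op f u g v x) y =
    dot_plus (f \* Pplus x) y + dot_minus (g \* Pplus x) y + dot_plus (u \* Pminus x) y + dot_minus (v \* Pminus x) y.
Proof.
move=> hf hu hg hv hx hy; have hp := L2_Pplus hx; have hm := L2_Pminus hx.
have [h1 h2 h3 h4] : [/\ L2 (f \* Pplus x), L2 (g \* Pplus x), L2 (u \* Pminus x) & L2 (v \* Pminus x)].
  by split; exact: L2_mul.
have [p1 p2 p3 p4] : [/\ L2 (Pplus (f \* Pplus x)), L2 (Pminus (g \* Pplus x)),
    L2 (Pplus (u \* Pminus x)) & L2 (Pminus (v \* Pminus x))].
  by split; [exact: L2_Pplus|exact: L2_Pminus|exact: L2_Pplus|exact: L2_Pminus].
rewrite (dot_plusE h1 hy) (dot_minusE h2 hy) (dot_plusE h3 hy) (dot_minusE h4 hy).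
have p12 := L2D p1 p2; have p123 := L2D p12 p3.
by rewrite /cauchy_op (dotDl p123 p4 hy) (dotDl p12 p3 hy) (dotDl p1 p2 hy).
Qed.

(** Taking adjoints conjugates the four entries and exchanges the roles of [u]
    and [g]. *)
Lemma cauchy_adjoint f u g v x y : Linf f -> Linf u -> Linf g -> Linf v -> L2 x -> L2 y ->
  dot (cauchy_op f u g v x) y = dot x (cauchy_op (bar f) (bar g) (bar u) (bar v) y).
Proof.
move=> hf hu hg hv hx hy.
have add4 (a a' b b' c c' d d' : C) : a = a' -> b = b' -> c = c' -> d = d' ->
  a + b + c + d = a' + c' + b' + d' by move=> -> -> -> ->; ring.
have conjD4 (a b c d : C) : (a + b + c + d)^* = a^* + b^* + c^* + d^* by rewrite !rmorphD.
have adj1 h : Linf h -> dot_plus (h \* Pplus x) y = (dot_plus (bar h \* Pplus y) x)^*.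
  move=> hh; have [l m] := (L2_mul (Linf_bar hh) (L2_Pplus hy), L2_mul hh (L2_Pplus hx)).
  by rewrite -[RHS](dot_plusC l hx) [RHS](dot_plusE hx l) [LHS](dot_plusEr m hy); exact: dot_mul.
have adj2 h : Linf h -> dot_minus (h \* Pplus x) y = (dot_plus (bar h \* Pminus y) x)^*.
  move=> hh; have [l m] := (L2_mul (Linf_bar hh) (L2_Pminus hy), L2_mul hh (L2_Pplus hx)).
  by rewrite -[RHS](dot_plusC l hx) [RHS](dot_plusE hx l) [LHS](dot_minusEr m hy); exact: dot_mul.
have adj3 h : Linf h -> dot_plus (h \* Pminus x) y = (dot_minus (bar h \* Pplus y) x)^*.
  move=> hh; have [l m] := (L2_mul (Linf_bar hh) (L2_Pplus hy), L2_mul hh (L2_Pminus hx)).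
  by rewrite -[RHS](dot_minusC l hx) [RHS](dot_minusE hx l) [LHS](dot_plusEr m hy); exact: dot_mul.
have adj4 h : Linf h -> dot_minus (h \* Pminus x) y = (dot_minus (bar h \* Pminus y) x)^*.
  move=> hh; have [l m] := (L2_mul (Linf_bar hh) (L2_Pminus hy), L2_mul hh (L2_Pminus hx)).
  by rewrite -[RHS](dot_minusC l hx) [RHS](dot_minusE hx l) [LHS](dot_minusEr m hy); exact: dot_mul.
have [[[bf bu] bg] bv] := (Linf_bar hf, Linf_bar hu, Linf_bar hg, Linf_bar hv).
rewrite [LHS](dot_cauchy hf hu hg hv hx hy) [RHS](dotC (L2_cauchy bf bg bu bv hy) hx).
rewrite [X in X^*](dot_cauchy bf bg bu bv hy hx) conjD4.
by apply: add4; [exact: adj1|exact: adj2|exact: adj3|exact: adj4].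
Qed.

Lemma dot_cauchy_zpow f u g v j y : Linf f -> Linf u -> Linf g -> Linf v -> L2 y ->
  dot (cauchy_op f u g v (e j)) y =
    if 0 <= j then dot_plus (f \* e j) y + dot_minus (g \* e j) y
    else dot_plus (u \* e j) y + dot_minus (v \* e j) y.
Proof.
move=> hf hu hg hv hy; have he : L2 (e j) := L2_zpow R j.
have hp := L2_Pplus he; have hm := L2_Pminus he.
have hpb h' : Linf h' -> L2 (bar h' \* Pplus y).
  by move=> hh; apply: L2_mul (Linf_bar hh) (L2_Pplus hy).
have hmb h' : Linf h' -> L2 (bar h' \* Pminus y).
  by move=> hh; apply: L2_mul (Linf_bar hh) (L2_Pminus hy).
have X h' x1 x2 : Linf h' -> L2 x1 -> L2 x2 -> (forall n, fourier x1 n = fourier x2 n) ->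
    dot_plus (h' \* x1) y = dot_plus (h' \* x2) y.
  move=> hh h1 h2 E; rewrite !dot_plusEr ?dot_mul //; do ?exact: L2_mul.
  by apply: dot_fourier_l => //; apply: hpb.
have Y h' x1 x2 : Linf h' -> L2 x1 -> L2 x2 -> (forall n, fourier x1 n = fourier x2 n) ->
    dot_minus (h' \* x1) y = dot_minus (h' \* x2) y.
  move=> hh h1 h2 E; rewrite !dot_minusEr ?dot_mul //; do ?exact: L2_mul.
  by apply: dot_fourier_l => //; apply: hmb.
have h0 : L2 (0 \*o e j) by exact: L2Z.
have X0 h' : Linf h' -> dot_plus (h' \* (0 \*o e j)) y = 0.
  move=> hh; rewrite mulfZ.
  by rewrite dot_plusZl ?mul0r //; exact: L2_mul.
have Y0 h' : Linf h' -> dot_minus (h' \* (0 \*o e j)) y = 0.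
  move=> hh; rewrite mulfZ.
  by rewrite dot_minusZl ?mul0r //; exact: L2_mul.
rewrite dot_cauchy //; case: ifPn => j0.
  have E n : fourier (Pplus (e j)) n = fourier (e j) n.
    rewrite fourier_Pplus //; case: ifPn => // n0.
    by rewrite fourier_zpow; case: eqP n0 => // <-; rewrite j0.
  have E0 n : fourier (Pminus (e j)) n = fourier (0 \*o e j) n.
    rewrite fourier_Pminus // fourierZ // mul0r fourier_zpow; case: ifPn => // n0.
    by case: eqP n0 => // <-; rewrite j0.
  rewrite (X f _ _ hf hp he E) (Y g _ _ hg hp he E) (X u _ _ hu hm h0 E0) (Y v _ _ hv hm h0 E0).
  by rewrite X0 // Y0 // !addr0.
have E n : fourier (Pplus (e j)) n = fourier (0 \*o e j) n.
  rewrite fourier_Pplus // fourierZ // mul0r fourier_zpow; case: ifPn => // n0.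
  by case: eqP n0 j0 => // <- ->.
have E0 n : fourier (Pminus (e j)) n = fourier (e j) n.
  rewrite fourier_Pminus //; case: ifPn => // n0.
  by rewrite fourier_zpow; case: eqP n0 j0 => // <- ->.
rewrite (X f _ _ hf hp h0 E) (Y g _ _ hg hp h0 E) (X u _ _ hu hm he E0) (Y v _ _ hv hm he E0).
by rewrite X0 // Y0 // !add0r.
Qed.

(** If [x] acts like [P_+ a + P_- b] and [y] like [P_+ a' + P_- b'] in inner
    products, then the mixed terms drop out by orthogonality. *)
Lemma dot_mix x y a b a' b' : L2 x -> L2 y -> L2 a -> L2 b -> L2 a' -> L2 b' ->
  (forall z, L2 z -> dot x z = dot_plus a z + dot_minus b z) ->
  (forall z, L2 z -> dot y z = dot_plus a' z + dot_minus b' z) ->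
  dot x y = dot_plus a a' + dot_minus b b'.
Proof.
move=> hx hy ha hb ha' hb' X Y.
have [pa mb] := (L2_Pplus ha, L2_Pminus hb).
have ps : L2 (Pplus a \+ Pminus b) by exact: L2D.
have -> : dot x y = dot (Pplus a \+ Pminus b) y.
  by rewrite X // dotDl // dot_plusE // dot_minusE.
have [pa' mb'] := (L2_Pplus ha', L2_Pminus hb').
have E1 : dot_plus (Pplus a \+ Pminus b) a' = dot_plus a a'.
  rewrite dot_plus.unlock; apply: (dot_fourier_l pa' (L2_Pplus ps) pa) => n.
  rewrite (fourier_Pplus n ps) (fourierD n pa mb) (fourier_Pminus n hb) (fourier_Pplus n ha).
  by case: (0 <= n); rewrite ?addr0.
have E2 : dot_minus (Pplus a \+ Pminus b) b' = dot_minus b b'.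
  rewrite dot_minus.unlock; apply: (dot_fourier_l mb' (L2_Pminus ps) mb) => n.
  rewrite (fourier_Pminus n ps) (fourierD n pa mb) (fourier_Pminus n hb) (fourier_Pplus n ha).
  by case: (0 <= n); rewrite ?add0r.
rewrite [LHS](dotC hy ps) (Y _ ps) rmorphD /=.
by rewrite -[X in X + _](dot_plusC ha' ps) -[X in _ + X](dot_minusC hb' ps) E1 E2.
Qed.

Definition entry f1 u1 g1 v1 f2 u2 g2 v2 i j : C :=
  dot (cauchy_op f1 u1 g1 v1 (cauchy_op f2 u2 g2 v2 (e j))) (e i).

(** One application of [R_2] to [z^j], and one of the adjoint of [R_1] to [z^i]. *)
Lemma entryE f1 u1 g1 v1 f2 u2 g2 v2 i j :
  Linf f1 -> Linf u1 -> Linf g1 -> Linf v1 -> Linf f2 -> Linf u2 -> Linf g2 -> Linf v2 ->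
  entry f1 u1 g1 v1 f2 u2 g2 v2 i j =
  dot_plus ((if 0 <= j then f2 else u2) \* e j) (bar (if 0 <= i then f1 else g1) \* e i) +
  dot_minus ((if 0 <= j then g2 else v2) \* e j) (bar (if 0 <= i then u1 else v1) \* e i).
Proof.
move=> hf1 hu1 hg1 hv1 hf2 hu2 hg2 hv2.
have [ei ej] : L2 (e i) /\ L2 (e j) by split; exact: L2_zpow.
have [[[bf1 bu1] bg1] bv1] := (Linf_bar hf1, Linf_bar hu1, Linf_bar hg1, Linf_bar hv1).
have h2 := L2_cauchy hf2 hu2 hg2 hv2 ej.
have h1 := L2_cauchy bf1 bg1 bu1 bv1 ei.
rewrite /entry (cauchy_adjoint hf1 hu1 hg1 hv1 h2 ei).
apply: (dot_mix h2 h1).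
- by apply: L2_mul => //; case: ifP.
- by apply: L2_mul => //; case: ifP.
- by apply: L2_mul => //; case: ifP.
- by apply: L2_mul => //; case: ifP.
- move=> z hz; rewrite (dot_cauchy_zpow j hf2 hu2 hg2 hv2 hz).
  by case: ifP.
- move=> z hz; rewrite (dot_cauchy_zpow i bf1 bg1 bu1 bv1 hz).
  by case: ifP.
Qed.

(** An operator on [L^2] that has an adjoint is determined by its matrix: for fixed
    [i], the inner product of [R_1 R_2 x - R_2 R_1 x] with [z^i] is that of [x]
    with a fixed element of [L^2], whose coefficients vanish if all entries do. *)
Lemma commuteP f1 u1 g1 v1 f2 u2 g2 v2 :
  Linf f1 -> Linf u1 -> Linf g1 -> Linf v1 -> Linf f2 -> Linf u2 -> Linf g2 -> Linf v2 ->
  commute_on_L2 (cauchy_op f1 u1 g1 v1) (cauchy_op f2 u2 g2 v2) <->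
  forall i j, entry f1 u1 g1 v1 f2 u2 g2 v2 i j = entry f2 u2 g2 v2 f1 u1 g1 v1 i j.
Proof.
move=> hf1 hu1 hg1 hv1 hf2 hu2 hg2 hv2.
have L1 x : L2 x -> L2 (cauchy_op f1 u1 g1 v1 x) by exact: L2_cauchy.
have L2' x : L2 x -> L2 (cauchy_op f2 u2 g2 v2 x) by exact: L2_cauchy.
have [[[bf1 bu1] bg1] bv1] := (Linf_bar hf1, Linf_bar hu1, Linf_bar hg1, Linf_bar hv1).
have [[[bf2 bu2] bg2] bv2] := (Linf_bar hf2, Linf_bar hu2, Linf_bar hg2, Linf_bar hv2).
split=> [h i j|h x hx].
  have ej : L2 (e j) := L2_zpow R j.
  rewrite /entry; apply: (fourier_aeq i _ _ (h _ ej)); first exact/L1/L2'.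
  exact/L2'/L1.
apply: aeq_fourier; [exact/L1/L2'|exact/L2'/L1|move=> i].
have ei : L2 (e i) := L2_zpow R i.
have K1 := L2_cauchy bf1 bg1 bu1 bv1 ei.
have K2 := L2_cauchy bf2 bg2 bu2 bv2 ei.
have A1 z : L2 z -> dot (cauchy_op f1 u1 g1 v1 (cauchy_op f2 u2 g2 v2 z)) (e i) =
    dot z (cauchy_op (bar f2) (bar g2) (bar u2) (bar v2) (cauchy_op (bar f1) (bar g1) (bar u1) (bar v1) (e i))).
  move=> hz; rewrite (cauchy_adjoint hf1 hu1 hg1 hv1 (L2' _ hz) ei).
  exact: cauchy_adjoint.
have A2 z : L2 z -> dot (cauchy_op f2 u2 g2 v2 (cauchy_op f1 u1 g1 v1 z)) (e i) =
    dot z (cauchy_op (bar f1) (bar g1) (bar u1) (bar v1) (cauchy_op (bar f2) (bar g2) (bar u2) (bar v2) (e i))).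
  move=> hz; rewrite (cauchy_adjoint hf2 hu2 hg2 hv2 (L1 _ hz) ei).
  exact: cauchy_adjoint.
rewrite [LHS](A1 _ hx) [RHS](A2 _ hx).
have M1 := L2_cauchy bf2 bg2 bu2 bv2 K1.
have M2 := L2_cauchy bf1 bg1 bu1 bv1 K2.
apply: (dot_fourier_r hx M1 M2) => j; have ej : L2 (e j) := L2_zpow R j.
have E := etrans (esym (A1 _ ej)) (etrans (h i j) (A2 _ ej)).
exact: etrans (dotC ej M1) (etrans (congr1 (fun k : C => k^* ) E) (esym (dotC ej M2))).
Qed.

End Operators.

(** * Products of operators that have a symbol *)

HB.lock Definition mulcoef (R : realType) (x y : cfun R) (n : int) : R[i] := fourier (x \* y) n.

Section Symbols.
Local Open Scope classical_set_scope.
Local Open Scope ring_scope.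
Variable R : realType.
Local Notation C := R[i].
Local Notation e := (@zpow R).
Implicit Types (x y z a b f g u v : cfun R) (w : circle R) (n i j : int) (k l : C).

Lemma mulcoefC x y n : mulcoef x y n = mulcoef y x n.
Proof. by rewrite mulcoef.unlock mulfC. Qed.

Lemma mulfBl x y z : (x \- y) \* z = (x \* z) \- (y \* z).
Proof. by apply/funext => w /=; rewrite mulrBl. Qed.
Lemma mulfZl k x z : (k \*o x) \* z = k \*o (x \* z).
Proof. by apply/funext => w /=; rewrite mulrA. Qed.

Lemma mulcoefE x y i j : Linf x -> Linf y ->
  mulcoef x y (i - j) = dot_plus (y \* e j) (bar x \* e i) + dot_minus (y \* e j) (bar x \* e i).
Proof.
move=> hx hy; have [ei ej] : L2 (e i) /\ L2 (e j) by split; exact: L2_zpow.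
have l1 := L2_mul hy ej; have l2 := L2_mul (Linf_bar hx) ei.
rewrite -(dot_plus_minus l1 l2) -dot_mul mulcoef.unlock -fourier_shift.
rewrite /fourier (_ : _ \* _ = x \* (y \* e j)) //.
by apply/funext => w /=; ring.
Qed.

Lemma analytic_shift g j : analytic g -> 0 <= j -> analytic (g \* e j).
Proof. by move=> ag j0 n n0; rewrite mulfC fourier_shift ag // subr_lt0 (lt_le_trans n0). Qed.

Lemma analytic_bar_shift f i : Linf f -> coanalytic f -> 0 <= i -> analytic (bar f \* e i).
Proof.
move=> hf cf i0 n n0; rewrite mulfC fourier_shift fourier_bar; last exact: Linf_L2.
by rewrite cf ?rmorph0 // opprB subr_gt0 (lt_le_trans n0).
Qed.

Lemma dot_minus_right0 a f i : L2 a -> Linf f -> coanalytic f -> 0 <= i -> dot_minus a (bar f \* e i) = 0.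
Proof.
move=> ha hf cf i0; have l := L2_mul (Linf_bar hf) (L2_zpow R i).
by rewrite (dot_minusC l ha) (dot_minus_eq0 l ha (analytic_bar_shift hf cf i0)) rmorph0.
Qed.

Lemma dot_plus_right0 a g i : L2 a -> Linf g -> analytic g -> i < 0 -> dot_plus a (bar g \* e i) = 0.
Proof.
move=> ha hg ag i0; have l := L2_mul (Linf_bar hg) (L2_zpow R i).
rewrite (dot_plusC l ha) (dot_plus_eq0 l ha) ?rmorph0 // => n n0.
rewrite mulfC fourier_shift fourier_bar; last exact: Linf_L2.
by rewrite ag ?rmorph0 // opprB subr_lt0 (lt_le_trans i0).
Qed.

Lemma dot_minus_left0 b g j : L2 b -> Linf g -> analytic g -> 0 <= j -> dot_minus (g \* e j) b = 0.
Proof.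
move=> hb hg ag j0; have l := L2_mul hg (L2_zpow R j).
exact: (dot_minus_eq0 l hb (analytic_shift ag j0)).
Qed.

Lemma dot_plus_left0 b v j : L2 b -> Linf v -> coanalytic v -> j < 0 -> dot_plus (v \* e j) b = 0.
Proof.
move=> hb hv cv j0; have l := L2_mul hv (L2_zpow R j).
apply: (dot_plus_eq0 l hb) => n n0.
by rewrite mulfC fourier_shift cv // subr_gt0 (lt_le_trans j0).
Qed.

(** [conj(f - l u) z^i] is analytic, hence has no image under [P_-]. The three
    lemmas that follow are the corresponding facts for the other factors. *)
Lemma dot_minus_rightZ a f u i l : L2 a -> Linf f -> Linf u -> coanalytic (f \- (l \*o u)) -> 0 <= i ->
  dot_minus a (bar f \* e i) = l * dot_minus a (bar u \* e i).
Proof.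
move=> ha hf hu cf i0.
have l1 := L2_mul (Linf_bar hf) (L2_zpow R i); have l2 := L2_mul (Linf_bar hu) (L2_zpow R i).
have hfu : Linf (f \- (l \*o u)) by apply: LinfB => //; exact: LinfZ.
have := dot_minus_right0 ha hfu cf i0.
rewrite -barB -barZ mulfBl mulfZl.
have l3 : L2 (l^* \*o (bar u \* e i)) by exact: L2Z.
have l4 : L2 ((bar f \* e i) \- (l^* \*o (bar u \* e i))) by exact: L2B.
rewrite [dot_minus a _](dot_minusC l4 ha) (dot_minusBl l1 l3 ha) (dot_minusZl _ l2 ha) rmorphB rmorphM /= conjCK.
rewrite -[X in X - _](dot_minusC l1 ha) -[X in _ * X](dot_minusC l2 ha).
by move/eqP; rewrite subr_eq0 => /eqP.
Qed.

Lemma dot_plus_rightZ a g v i l : L2 a -> Linf g -> Linf v -> analytic (g \- (l \*o v)) -> i < 0 ->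
  dot_plus a (bar g \* e i) = l * dot_plus a (bar v \* e i).
Proof.
move=> ha hf hu cf i0.
have l1 := L2_mul (Linf_bar hf) (L2_zpow R i); have l2 := L2_mul (Linf_bar hu) (L2_zpow R i).
have hfu : Linf (g \- (l \*o v)) by apply: LinfB => //; exact: LinfZ.
have := dot_plus_right0 ha hfu cf i0.
rewrite -barB -barZ mulfBl mulfZl.
have l3 : L2 (l^* \*o (bar v \* e i)) by exact: L2Z.
have l4 : L2 ((bar g \* e i) \- (l^* \*o (bar v \* e i))) by exact: L2B.
rewrite [dot_plus a _](dot_plusC l4 ha) (dot_plusBl l1 l3 ha) (dot_plusZl _ l2 ha) rmorphB rmorphM /= conjCK.
rewrite -[X in X - _](dot_plusC l1 ha) -[X in _ * X](dot_plusC l2 ha).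
by move/eqP; rewrite subr_eq0 => /eqP.
Qed.

Lemma dot_minus_leftZ b g f j l : L2 b -> Linf g -> Linf f -> analytic (g \- (l \*o f)) -> 0 <= j ->
  dot_minus (g \* e j) b = l * dot_minus (f \* e j) b.
Proof.
move=> hb hg hf ag j0.
have l1 := L2_mul hg (L2_zpow R j); have l2 := L2_mul hf (L2_zpow R j).
have hgf : Linf (g \- (l \*o f)) by apply: LinfB => //; exact: LinfZ.
have := dot_minus_left0 hb hgf ag j0.
rewrite mulfBl mulfZl (dot_minusBl l1 (L2Z _ l2) hb) (dot_minusZl _ l2 hb).
by move/eqP; rewrite subr_eq0 => /eqP.
Qed.

Lemma dot_plus_leftZ b v u j l : L2 b -> Linf v -> Linf u -> coanalytic (v \- (l \*o u)) -> j < 0 ->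
  dot_plus (v \* e j) b = l * dot_plus (u \* e j) b.
Proof.
move=> hb hg hf ag j0.
have l1 := L2_mul hg (L2_zpow R j); have l2 := L2_mul hf (L2_zpow R j).
have hgf : Linf (v \- (l \*o u)) by apply: LinfB => //; exact: LinfZ.
have := dot_plus_left0 hb hgf ag j0.
rewrite mulfBl mulfZl (dot_plusBl l1 (L2Z _ l2) hb) (dot_plusZl _ l2 hb).
by move/eqP; rewrite subr_eq0 => /eqP.
Qed.

(** The blocks of [R_1 R_2] are Toeplitz and Hankel operators, with the symbols
    [f1 f2] and [v1 v2] on the diagonal. Off the diagonal the symbols are given
    by their coefficients: [gg n] is used for [n < 0] only, and [uu n] for
    [0 < n] only. *)
Definition has_symbol f1 u1 g1 v1 f2 u2 g2 v2 (gg uu : int -> C) := forall i j,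
  entry f1 u1 g1 v1 f2 u2 g2 v2 i j =
  if 0 <= i then (if 0 <= j then mulcoef f1 f2 (i - j) else uu (i - j))
  else (if 0 <= j then gg (i - j) else mulcoef v1 v2 (i - j)).

Lemma commute_symbols f1 u1 g1 v1 f2 u2 g2 v2 gg uu gg' uu' :
  Linf f1 -> Linf u1 -> Linf g1 -> Linf v1 -> Linf f2 -> Linf u2 -> Linf g2 -> Linf v2 ->
  has_symbol f1 u1 g1 v1 f2 u2 g2 v2 gg uu -> has_symbol f2 u2 g2 v2 f1 u1 g1 v1 gg' uu' ->
  (commute_on_L2 (cauchy_op f1 u1 g1 v1) (cauchy_op f2 u2 g2 v2) <->
   (forall n, n < 0 -> gg n = gg' n) /\ (forall n, 0 < n -> uu n = uu' n)).
Proof.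
move=> hf1 hu1 hg1 hv1 hf2 hu2 hg2 hv2 S S'.
apply: (iff_trans (commuteP hf1 hu1 hg1 hv1 hf2 hu2 hg2 hv2)); split=> [h|[G U] i j].
  split=> n n0.
    have := h n 0; rewrite S S' lexx subr0.
    by rewrite leNgt n0.
  (* the entry in row [n - 1] and column [-1] lies in the upper right block *)
  have := h (n - 1) (- 1); rewrite S S' opprK subrK.
  have -> : 0 <= n - 1 by lia.
  by [].
rewrite S S' (mulcoefC f1 f2) (mulcoefC v1 v2); case: (leP 0 i) => i0; case: (leP 0 j) => j0 //.
  by apply: U; lia.
by apply: G; lia.
Qed.

Section Types.
Variables (f1 u1 g1 v1 f2 u2 g2 v2 : cfun R).
Hypotheses (hf1 : Linf f1) (hu1 : Linf u1) (hg1 : Linf g1) (hv1 : Linf v1).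
Hypotheses (hf2 : Linf f2) (hu2 : Linf u2) (hg2 : Linf g2) (hv2 : Linf v2).
Notation has_symbol12 := (has_symbol f1 u1 g1 v1 f2 u2 g2 v2).

Let E i : L2 (e i) := L2_zpow R i.
Let Bf1 i : L2 (bar f1 \* e i) := L2_mul (Linf_bar hf1) (E i).
Let Bu1 i : L2 (bar u1 \* e i) := L2_mul (Linf_bar hu1) (E i).
Let Bg1 i : L2 (bar g1 \* e i) := L2_mul (Linf_bar hg1) (E i).
Let Bv1 i : L2 (bar v1 \* e i) := L2_mul (Linf_bar hv1) (E i).
Let Mf2 i : L2 (f2 \* e i) := L2_mul hf2 (E i).
Let Mu2 i : L2 (u2 \* e i) := L2_mul hu2 (E i).
Let Mg2 i : L2 (g2 \* e i) := L2_mul hg2 (E i).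
Let Mv2 i : L2 (v2 \* e i) := L2_mul hv2 (E i).

(** In this lemma and the next four, the factors of [W_L] are
    [p = (f1, g1)], [q = (f2, u2)], [r = (u1, v1)] and [s = (g2, v2)] in terms of
    the symbols, and the letters in the name say which two of them vanish. Each
    block is treated alike: the terms that involve a vanishing factor are dropped,
    in the entry and in the coefficient of the product. *)
Lemma has_symbol_PR : coanalytic f1 -> analytic g1 -> coanalytic u1 -> analytic v1 ->
  has_symbol12 (mulcoef v1 g2) (mulcoef f1 u2).
Proof.
move=> cf ag cu av i j; rewrite (entryE i j hf1 hu1 hg1 hv1 hf2 hu2 hg2 hv2).
case: (leP 0 i) => i0; case: (leP 0 j) => j0; rewrite mulcoefE //.
- by rewrite (dot_minus_right0 (Mg2 j) hu1 cu i0) (dot_minus_right0 (Mf2 j) hf1 cf i0).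
- by rewrite (dot_minus_right0 (Mv2 j) hu1 cu i0) (dot_minus_right0 (Mu2 j) hf1 cf i0).
- by rewrite (dot_plus_right0 (Mf2 j) hg1 ag i0) (dot_plus_right0 (Mg2 j) hv1 av i0).
- by rewrite (dot_plus_right0 (Mu2 j) hg1 ag i0) (dot_plus_right0 (Mv2 j) hv1 av i0).
Qed.

Lemma has_symbol_PS : coanalytic f1 -> analytic g1 -> analytic g2 -> coanalytic v2 ->
  has_symbol12 (fun=> 0) (fun n => mulcoef f1 u2 n + mulcoef u1 v2 n).
Proof.
move=> cf ag ag2 cv i j; rewrite (entryE i j hf1 hu1 hg1 hv1 hf2 hu2 hg2 hv2).
case: (leP 0 i) => i0; case: (leP 0 j) => j0; rewrite ?mulcoefE //.
- by rewrite (dot_minus_left0 (Bu1 i) hg2 ag2 j0) (dot_minus_right0 (Mf2 j) hf1 cf i0).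
- by rewrite (dot_minus_right0 (Mu2 j) hf1 cf i0) (dot_plus_left0 (Bu1 i) hv2 cv j0) addr0 add0r.
- by rewrite (dot_plus_right0 (Mf2 j) hg1 ag i0) (dot_minus_left0 (Bv1 i) hg2 ag2 j0) addr0.
- by rewrite (dot_plus_right0 (Mu2 j) hg1 ag i0) (dot_plus_left0 (Bv1 i) hv2 cv j0).
Qed.

Lemma has_symbol_QR : analytic f2 -> coanalytic u2 -> coanalytic u1 -> analytic v1 ->
  has_symbol12 (fun n => mulcoef g1 f2 n + mulcoef v1 g2 n) (fun=> 0).
Proof.
move=> af cu2 cu av i j; rewrite (entryE i j hf1 hu1 hg1 hv1 hf2 hu2 hg2 hv2).
case: (leP 0 i) => i0; case: (leP 0 j) => j0; rewrite ?mulcoefE //.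
- by rewrite (dot_minus_right0 (Mg2 j) hu1 cu i0) (dot_minus_left0 (Bf1 i) hf2 af j0).
- by rewrite (dot_plus_left0 (Bf1 i) hu2 cu2 j0) (dot_minus_right0 (Mv2 j) hu1 cu i0) addr0.
- by rewrite (dot_minus_left0 (Bg1 i) hf2 af j0) (dot_plus_right0 (Mg2 j) hv1 av i0) addr0 add0r.
- by rewrite (dot_plus_left0 (Bg1 i) hu2 cu2 j0) (dot_plus_right0 (Mv2 j) hv1 av i0).
Qed.

Lemma has_symbol_QS : analytic f2 -> coanalytic u2 -> analytic g2 -> coanalytic v2 ->
  has_symbol12 (mulcoef g1 f2) (mulcoef u1 v2).
Proof.
move=> af cu2 ag2 cv2 i j; rewrite (entryE i j hf1 hu1 hg1 hv1 hf2 hu2 hg2 hv2).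
case: (leP 0 i) => i0; case: (leP 0 j) => j0; rewrite ?mulcoefE //.
- by rewrite (dot_minus_left0 (Bu1 i) hg2 ag2 j0) (dot_minus_left0 (Bf1 i) hf2 af j0).
- by rewrite (dot_plus_left0 (Bf1 i) hu2 cu2 j0) (dot_plus_left0 (Bu1 i) hv2 cv2 j0).
- by rewrite (dot_minus_left0 (Bv1 i) hg2 ag2 j0) (dot_minus_left0 (Bg1 i) hf2 af j0).
- by rewrite (dot_plus_left0 (Bg1 i) hu2 cu2 j0) (dot_plus_left0 (Bv1 i) hv2 cv2 j0).
Qed.

(** Here [p = l r] and [s = conj(l) q], and in each block one of the two terms is
    a multiple of the term that completes the other one. *)
Lemma has_symbol_scalar l : l != 0 -> coanalytic (f1 \- (l \*o u1)) -> analytic (g1 \- (l \*o v1)) ->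
  analytic (g2 \- (l \*o f2)) -> coanalytic (v2 \- (l \*o u2)) ->
  has_symbol12 (fun n => l * mulcoef v1 f2 n) (fun n => l^-1 * mulcoef f1 v2 n).
Proof.
move=> l0 cf ag ag2 cv2 i j; rewrite (entryE i j hf1 hu1 hg1 hv1 hf2 hu2 hg2 hv2).
case: (leP 0 i) => i0; case: (leP 0 j) => j0; rewrite ?mulcoefE //.
- by rewrite (dot_minus_leftZ (Bu1 i) hg2 hf2 ag2 j0) (dot_minus_rightZ (Mf2 j) hf1 hu1 cf i0).
- by rewrite (dot_minus_rightZ (Mv2 j) hf1 hu1 cf i0) (dot_plus_leftZ (Bf1 i) hv2 hu2 cv2 j0) -mulrDr mulKf.
- by rewrite (dot_plus_rightZ (Mf2 j) hg1 hv1 ag i0) (dot_minus_leftZ (Bv1 i) hg2 hf2 ag2 j0) mulrDr.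
- by rewrite (dot_plus_rightZ (Mu2 j) hg1 hv1 ag i0) (dot_plus_leftZ (Bv1 i) hv2 hu2 cv2 j0).
Qed.
End Types.

End Symbols.

(** * Equality of rank-one operators *)

Section RankOne.
Local Open Scope classical_set_scope.
Local Open Scope ring_scope.
Variable R : realType.
Local Notation C := R[i].
Implicit Types (x y z f g u v : cfun R) (w : circle R) (n : int) (k l : C).
Implicit Types (p q r s t : cfun R * cfun R).

Definition L22 p := L2 p.1 /\ L2 p.2.
Definition eq2 p q := aeq p.1 q.1 /\ aeq p.2 q.2.
Definition scale2 k p : cfun R * cfun R := (k \*o p.1, k \*o p.2).
Definition zero2 : cfun R * cfun R := (fun=> 0, fun=> 0).

Lemma aeq_scale0 k x : aeq (k \*o x) (fun=> 0) -> k = 0 \/ aeq x (fun=> 0).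
Proof.
have [->|k0] := eqVneq k 0; first by left.
move=> h; right; move: h; apply: ae_sub => t h At; apply/eqP; have /eqP := h At.
by rewrite /= mulf_eq0 (negbTE k0).
Qed.

Lemma dot2xx_eq0 p : L22 p -> dot2 p p = 0 -> eq2 p zero2.
Proof.
move=> [h1 h2]; rewrite /dot2 !dotxx => /(congr1 (@complex.Re R)) /= h.
have := nrm2_ge0 p.1; have := nrm2_ge0 p.2 => n2 n1.
by split; apply: nrm2_eq0 => //; lra.
Qed.

Lemma dot2_zero p q : L22 p -> L22 q -> eq2 q zero2 -> dot2 p q = 0.
Proof.
have D x y : L2 x -> L2 y -> aeq y (fun=> 0) -> dot x y = 0.
  move=> hx hy y0; rewrite (dot_aeq hx hx hy (L2Z 0 hy) (aeq_refl x)).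
    by rewrite dotZr // rmorph0 mul0r.
  by move: y0; apply: ae_sub => t h At; rewrite /= mul0r h.
by move=> [p1 p2] [q1 q2] [z1 z2]; rewrite /dot2 !D // addr0.
Qed.

(** If [p] and [q] are nonzero, evaluation at [q] gives [p = l r] with
    [l = <q, s> / <q, q>]. Then the functional [x |-> <x, conj(l) q - s>] vanishes,
    in particular at [conj(l) q - s] itself. *)
Lemma rank_one_eq p q r s : L22 p -> L22 q -> L22 r -> L22 s ->
  zero_op2 (sub_op2 (otimes p q) (otimes r s)) ->
  ((eq2 p zero2 \/ eq2 q zero2) /\ (eq2 r zero2 \/ eq2 s zero2)) \/
  exists l, [/\ l != 0, eq2 p (scale2 l r) & eq2 s (scale2 l^* q)].
Proof.
move=> hp hq hr hs H.
have {}H t : L22 t -> eq2 (scale2 (dot2 t q) p) (scale2 (dot2 t s) r).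
  move=> [t1 t2]; have [h1 h2] := H t t1 t2.
  split; [move: h1|move: h2]; apply: ae_sub => a h At;
    by apply/eqP; rewrite -subr_eq0; apply/eqP; exact: h.
have Z k t : eq2 (scale2 k t) zero2 -> k = 0 \/ eq2 t zero2.
  move=> [/aeq_scale0 [->|t1] /aeq_scale0 [k0|t2]]; try by left.
  by right.
have hss : (dot2 s q = 0 \/ eq2 p zero2) -> eq2 r zero2 \/ eq2 s zero2.
  move=> c; have [h1 h2] := H s hs.
  have /Z[/(dot2xx_eq0 hs)|] : eq2 (scale2 (dot2 s s) r) zero2; [|by right|by left].
  case: c => [c|[c1 c2]].
    by split; [move: h1|move: h2]; apply: ae_sub => a h At; rewrite -h //= c mul0r.
  by split; [move: h1 c1|move: h2 c2]; apply: ae_sub2 => a h c At; rewrite -h //= c // mulr0.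
have [p0|p0] := pselect (eq2 p zero2).
  by left; split; [left|apply: hss; right].
have [q0|q0] := pselect (eq2 q zero2).
  by left; split; [right|apply: hss; left; exact: dot2_zero].
right; have d0 : dot2 q q != 0 by apply/eqP => /(dot2xx_eq0 hq).
pose l := dot2 q s / dot2 q q.
have pl : eq2 p (scale2 l r).
  have [h1 h2] := H q hq; split; [move: h1|move: h2]; apply: ae_sub => a h At;
    by apply: (mulfI d0); rewrite [LHS](h At) /= /l mulrA [dot2 q q * _]mulrC divfK.
have l0 : l != 0.
  apply/eqP => l0; apply: p0; case: pl; rewrite l0 => p1 p2.
  by split; [move: p1|move: p2]; apply: ae_sub => a h At; rewrite h //= mul0r.
have r0 : ~ eq2 r zero2.
  move=> [r1 r2]; apply: p0; case: pl => p1 p2.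
  by split; [move: p1 r1|move: p2 r2]; apply: ae_sub2 => a h k At; rewrite h //= k // mulr0.
exists l; split=> //.
pose t : cfun R * cfun R := (s.1 \- (l^* \*o q.1), s.2 \- (l^* \*o q.2)).
have [[q1 q2] [s1 s2]] := (hq, hs).
have ht : L22 t by split; apply: L2B => //; exact: L2Z.
have [[h1 h2] [p1 p2]] := (H t ht, pl).
have : eq2 (scale2 (dot2 t q * l - dot2 t s) r) zero2.
  split; [move: h1 p1|move: h2 p2]; apply: ae_sub2 => a h k At; move: (h At); rewrite /= k //= => {}h;
    by rewrite mulrBl -mulrA h subrr.
move=> /Z[D|//].
have tt : dot2 t t = 0.
  have -> : dot2 t t = dot2 t s - l * dot2 t q.
    have [t1 t2] := ht.
    have E a x y : L2 a -> L2 x -> L2 y -> dot a (x \- (l^* \*o y)) = dot a x - l * dot a y.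
      by move=> ha hx hy; rewrite (dotBr ha hx (L2Z _ hy)) (dotZr _ ha hy) conjCK.
    transitivity (dot t.1 (s.1 \- (l^* \*o q.1)) + dot t.2 (s.2 \- (l^* \*o q.2))); first by [].
    rewrite (E _ _ _ t1 s1 q1) (E _ _ _ t2 s2 q2) /dot2.
    by ring.
  by move: D => /eqP; rewrite subr_eq0 => /eqP <-; rewrite mulrC subrr.
have [z1 z2] := dot2xx_eq0 ht tt.
by split; [move: z1|move: z2]; apply: ae_sub => a h At; apply/eqP; rewrite -subr_eq0; apply/eqP; exact: h.
Qed.

Lemma VE x : V x = bar (zpow 1 \* x).
Proof. by apply/funext => w; rewrite /V /bar /zpow /= expr1z rmorphM. Qed.

Lemma L2_V x : L2 x -> L2 (V x).
Proof. by move=> hx; rewrite VE; apply: L2_bar; apply: L2_mul (Linf_zpow R 1) hx. Qed.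

Lemma V_scale k x y : aeq (V x) (k \*o V y) -> aeq x (k^* \*o y).
Proof.
have P w : V x w = k * V y w -> x w = k^* * y w.
  move=> /(congr1 (fun a : C => a^* )); rewrite /V !rmorphM /= !conjCK mulrCA.
  exact: (mulfI (circle_neq0 w)).
by apply: ae_sub => t h At; apply: P; exact: h.
Qed.

Lemma V_zero x : aeq (V x) (fun=> 0) -> aeq x (fun=> 0).
Proof.
apply: ae_sub => t h At; have /eqP := h At; rewrite /V mulf_eq0 !conjC_eq0.
by rewrite (negbTE (circle_neq0 _)) => /eqP.
Qed.

Lemma Pminus_zero x : L2 x -> aeq (Pminus x) (fun=> 0) -> analytic x.
Proof.
move=> hx h n n0; have := fourier_aeq n (L2_Pminus hx) (L2_cst 0) h.
by rewrite fourier_zero fourier_Pminus // leNgt n0.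
Qed.

Lemma Pminus_scale k x y : L2 x -> L2 y -> aeq (Pminus x) (k \*o Pminus y) -> analytic (x \- (k \*o y)).
Proof.
move=> hx hy h n n0; have hP := L2_Pminus hy.
have := fourier_aeq n (L2_Pminus hx) (L2Z k hP) h.
rewrite fourierZ // !fourier_Pminus // leNgt n0 /= => E.
by rewrite fourierB ?fourierZ ?E ?subrr //; exact: L2Z.
Qed.

Lemma analytic_bar x : L2 x -> analytic (bar x) -> coanalytic x.
Proof.
move=> hx ax n n0; have := ax (- n); rewrite fourier_bar // opprK oppr_lt0 => /(_ n0) /eqP.
by rewrite conjC_eq0 => /eqP.
Qed.

(** The four vectors of [rank_one_eq] are projections onto the complement of
    [H^2], possibly followed by the antilinear map [V]. In terms of the symbols a
    vanishing component is an analyticity condition, and a proportionality of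
    components is the analyticity of a combination. *)
Lemma W_types f1 u1 g1 v1 f2 u2 g2 v2 :
  Linf f1 -> Linf u1 -> Linf g1 -> Linf v1 -> Linf f2 -> Linf u2 -> Linf g2 -> Linf v2 ->
  zero_op2 (W f1 u1 g1 v1 f2 u2 g2 v2) ->
  (((coanalytic f1 /\ analytic g1) \/ (analytic f2 /\ coanalytic u2)) /\ ((coanalytic u1 /\ analytic v1) \/ (analytic g2 /\ coanalytic v2))) \/
  exists l, [/\ l != 0, coanalytic (f1 \- (l \*o u1)), analytic (g1 \- (l \*o v1)),
    analytic (g2 \- (l \*o f2)) & coanalytic (v2 \- (l \*o u2))].
Proof.
move=> hf1 hu1 hg1 hv1 hf2 hu2 hg2 hv2.
have [Lf1 [Lu1 [Lg1 Lv1]]] := conj (Linf_L2 hf1) (conj (Linf_L2 hu1) (conj (Linf_L2 hg1) (Linf_L2 hv1))).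
have [Lf2 [Lu2 [Lg2 Lv2]]] := conj (Linf_L2 hf2) (conj (Linf_L2 hu2) (conj (Linf_L2 hg2) (Linf_L2 hv2))).
have PV x : L2 x -> L2 (V (Pminus x)) by move=> hx; apply: L2_V; exact: L2_Pminus.
have zb x : L2 x -> aeq (V (Pminus (bar x))) (fun=> 0) -> coanalytic x.
  by move=> hx /V_zero /(Pminus_zero (L2_bar hx)) /(analytic_bar hx).
have za x : L2 x -> aeq (V (Pminus x)) (fun=> 0) -> analytic x.
  by move=> hx /V_zero /(Pminus_zero hx).
have zc x : L2 x -> aeq (Pminus (bar x)) (fun=> 0) -> coanalytic x.
  by move=> hx /(Pminus_zero (L2_bar hx)) /(analytic_bar hx).
have zd x : L2 x -> aeq (Pminus x) (fun=> 0) -> analytic x by exact: Pminus_zero.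
have cb k x y : L2 x -> L2 y -> analytic (bar x \- (k^* \*o bar y)) -> coanalytic (x \- (k \*o y)).
  by move=> hx hy; rewrite barZ barB => /analytic_bar; apply; apply: L2B => //; exact: L2Z.
case/rank_one_eq.
- by split; [apply: PV; exact: L2_bar|exact: L2_Pminus].
- by split; [exact: PV|apply: L2_Pminus; exact: L2_bar].
- by split; [apply: PV; exact: L2_bar|exact: L2_Pminus].
- by split; [exact: PV|apply: L2_Pminus; exact: L2_bar].
- move=> [pq rs]; left; split.
    case: pq => -[/= h1 h2]; [left|right]; split.
    + exact: zb h1.
    + exact: zd h2.
    + exact: za h1.
    + exact: zc h2.
  case: rs => -[/= h1 h2]; [left|right]; split.
  + exact: zb h1.
  + exact: zd h2.
  + exact: za h1.
  + exact: zc h2.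
move=> [l [l0 [/= /V_scale p1 p2] [/= /V_scale s1 s2]]]; right; exists l; split=> //.
- by apply: cb => //; apply: Pminus_scale => //; exact: L2_bar.
- exact: Pminus_scale.
- by rewrite conjCK in s1; exact: Pminus_scale.
- by apply: cb => //; apply: Pminus_scale => //; exact: L2_bar.
Qed.

End RankOne.

(** * Fourier coefficients of products of symbols *)

Section Algebra.
Local Open Scope classical_set_scope.
Local Open Scope ring_scope.
Variable R : realType.
Local Notation C := R[i].
Implicit Types (x y z a b c d f g u v : cfun R) (n : int) (k l m : C).

Lemma fourier_mul x y n : fourier (x \* y) n = mulcoef x y n.
Proof. by rewrite mulcoef.unlock. Qed.

Lemma mulcoefBl x y z n : Linf x -> Linf y -> Linf z -> mulcoef (x \- y) z n = mulcoef x z n - mulcoef y z n.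
Proof.
move=> hx hy hz; rewrite mulcoef.unlock mulfBl fourierB //; exact: L2_mul (Linf_L2 hz).
Qed.

Lemma mulcoefZl k x z n : Linf x -> Linf z -> mulcoef (k \*o x) z n = k * mulcoef x z n.
Proof.
move=> hx hz; rewrite mulcoef.unlock mulfZl fourierZ //; exact: L2_mul (Linf_L2 hz).
Qed.

Lemma mulcoef_analytic0 x y n : Linf x -> Linf y -> analytic x -> analytic y -> n < 0 -> mulcoef x y n = 0.
Proof. by move=> hx hy ax ay n0; rewrite -fourier_mul (analytic_mul hx hy ax ay). Qed.

Lemma mulcoef_coanalytic0 x y n : Linf x -> Linf y -> coanalytic x -> coanalytic y -> 0 < n -> mulcoef x y n = 0.
Proof. by move=> hx hy ax ay n0; rewrite -fourier_mul (coanalytic_mul hx hy ax ay). Qed.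

(** If [x - k y] is analytic, then it can be dropped from a product with an analytic
    function. *)
Lemma mulcoef_analyticZ x y z k n : Linf x -> Linf y -> Linf z -> analytic (x \- (k \*o y)) -> analytic z -> n < 0 ->
  mulcoef x z n = k * mulcoef y z n.
Proof.
move=> hx hy hz axy az n0; have hk := LinfZ k hy.
have := mulcoef_analytic0 (LinfB hx hk) hz axy az n0.
by rewrite mulcoefBl // mulcoefZl // => /eqP; rewrite subr_eq0 => /eqP.
Qed.

Lemma mulcoef_coanalyticZ x y z k n : Linf x -> Linf y -> Linf z -> coanalytic (x \- (k \*o y)) -> coanalytic z -> 0 < n ->
  mulcoef x z n = k * mulcoef y z n.
Proof.
move=> hx hy hz axy az n0; have hk := LinfZ k hy.
have := mulcoef_coanalytic0 (LinfB hx hk) hz axy az n0.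
by rewrite mulcoefBl // mulcoefZl // => /eqP; rewrite subr_eq0 => /eqP.
Qed.

Lemma fourier_subZ x y k n : Linf x -> Linf y -> fourier (x \- (k \*o y)) n = fourier x n - k * fourier y n.
Proof.
move=> hx hy; rewrite fourierB ?fourierZ //; do ?apply: L2Z; exact: Linf_L2.
Qed.

Lemma coanalytic_subZl x y k : Linf x -> Linf y -> coanalytic (x \- (k \*o y)) -> coanalytic y -> coanalytic x.
Proof.
by move=> hx hy axy ay n n0; have := axy n n0; rewrite fourier_subZ // ay // mulr0 subr0.
Qed.

Lemma analytic_subZr x y k : k != 0 -> Linf x -> Linf y -> analytic (x \- (k \*o y)) -> analytic x -> analytic y.
Proof.
move=> k0 hx hy axy ay n n0; have := axy n n0; rewrite fourier_subZ // ay // sub0r => /eqP.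
by rewrite oppr_eq0 mulf_eq0 (negbTE k0) => /eqP.
Qed.

Lemma fourier_BM x y z n : Linf x -> Linf y -> Linf z ->
  fourier ((x \- y) \* z) n = mulcoef x z n - mulcoef y z n.
Proof. by move=> hx hy hz; rewrite fourier_mul mulcoefBl. Qed.

Lemma fourier_BMB a b c x y z n : Linf a -> Linf b -> Linf c -> Linf x -> Linf y -> Linf z ->
  fourier (((a \- b) \* c) \- ((x \- y) \* z)) n = (mulcoef a c n - mulcoef b c n) - (mulcoef x z n - mulcoef y z n).
Proof.
move=> ha hb hc hx hy hz.
have [h1 h2] := (Linf_L2 (LinfM (LinfB ha hb) hc), Linf_L2 (LinfM (LinfB hx hy) hz)).
by rewrite (fourierB n h1 h2) (fourier_BM n ha hb hc) (fourier_BM n hx hy hz).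
Qed.

Lemma fourier_MDMB a b c d x y n : Linf a -> Linf b -> Linf c -> Linf d -> Linf x -> Linf y ->
  fourier (((a \* b) \+ (c \* d)) \- (x \* y)) n = mulcoef a b n + mulcoef c d n - mulcoef x y n.
Proof.
move=> ha hb hc hd hx hy.
have [h1 [h2 h3]] := conj (Linf_L2 (LinfM ha hb)) (conj (Linf_L2 (LinfM hc hd)) (Linf_L2 (LinfM hx hy))).
by rewrite (fourierB n (L2D h1 h2) h3) (fourierD n h1 h2) !fourier_mul.
Qed.

Lemma fourier_ZMB l m a b x y n : Linf a -> Linf b -> Linf x -> Linf y ->
  fourier ((l \*o (a \* b)) \- (m \*o (x \* y))) n = l * mulcoef a b n - m * mulcoef x y n.
Proof.
move=> ha hb hx hy.
have [h1 h3] := conj (Linf_L2 (LinfM ha hb)) (Linf_L2 (LinfM hx hy)).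
by rewrite (fourierB n (L2Z l h1) (L2Z m h3)) (fourierZ l n h1) (fourierZ m n h3) !fourier_mul.
Qed.

Lemma eq0_of (A B G : C) : A = B -> G = A - B -> G = 0.
Proof. by move=> -> ->; rewrite subrr. Qed.

Lemma eq_of (A B G : C) : G = 0 -> A - B = G -> A = B.
Proof. by move=> -> /eqP; rewrite subr_eq0 => /eqP. Qed.

Lemma analytic_subI x y k : Linf x -> Linf y -> analytic x -> analytic y -> analytic (x \- (k \*o y)).
Proof. by move=> hx hy ax ay n n0; rewrite fourier_subZ // ax // ay // mulr0 subrr. Qed.

Lemma coanalytic_subI x y k : Linf x -> Linf y -> coanalytic x -> coanalytic y -> coanalytic (x \- (k \*o y)).
Proof. by move=> hx hy ax ay n n0; rewrite fourier_subZ // ax // ay // mulr0 subrr. Qed.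

End Algebra.

Ltac linf := repeat match goal with
  | |- Linf (_ \- _) => apply: LinfB
  | |- Linf (_ \+ _) => apply: LinfD
  | |- Linf (_ \* _) => apply: LinfM
  | |- Linf (_ \*o _) => apply: LinfZ
  | |- Linf (bar _) => apply: Linf_bar
  | |- _ => assumption
  end.

(** Removes the products of two analytic symbols at negative indices, and those of
    two coanalytic symbols at positive indices. *)
Ltac kill := repeat match goal with
  | La : Linf ?a, Lb : Linf ?b, Ha : analytic ?a, Hb : analytic ?b, n0 : is_true (?n < 0) |- context [mulcoef ?a ?b ?n] =>
    rewrite (mulcoef_analytic0 La Lb Ha Hb n0)
  | La : Linf ?a, Lb : Linf ?b, Ha : coanalytic ?a, Hb : coanalytic ?b, n0 : is_true (0 < ?n) |- context [mulcoef ?a ?b ?n] =>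
    rewrite (mulcoef_coanalytic0 La Lb Ha Hb n0)
  end.

(** Fourier coefficients of combinations of products, in terms of those of the
    products of two symbols. *)
Ltac expand := rewrite ?fourier_BMB ?fourier_MDMB ?fourier_ZMB; linf; rewrite ?fourier_BM; linf.

(** Writes every product in one order only, as preparation for [ring]. *)
Ltac orient := repeat match goal with
  |- context [mulcoef ?a ?b ?n] => match goal with |- context [mulcoef b a n] => rewrite (mulcoefC b a n) end end.

(** Solves a linear goal [A = B -> G = 0] where [G] is [A - B] or [B - A]. *)
Ltac lin :=
  let h := fresh in
  move=> h; first [by apply: (eq0_of h); ring | by apply: (eq0_of (esym h)); ring].

(** Deduces the analyticity of a combination from [G] or [U], the equality of the
    off-diagonal symbols. *)
Ltac forward G U :=
  let n := fresh in let n0 := fresh in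
  move=> n n0; expand; first [have := G n n0 | have := U n n0]; rewrite /=; kill; orient; lin.

(** Deduces the equality of two off-diagonal symbols from one of the hypotheses of
    analyticity. *)
Ltac backward :=
  let n := fresh in let n0 := fresh in
  move=> n n0 /=; kill; rewrite ?(addr0, add0r, mulr0) //;
  match goal with
  | H : analytic _, n0 : is_true (?n < 0) |- _ =>
      have := H n n0; expand; kill; orient;
      let h := fresh in move=> h;
      first [by apply: (eq_of h); ring | by apply/esym; apply: (eq_of h); ring]
  | H : coanalytic _, n0 : is_true (0 < ?n) |- _ =>
      have := H n n0; expand; kill; orient;
      let h := fresh in move=> h;
      first [by apply: (eq_of h); ring | by apply/esym; apply: (eq_of h); ring]
  end.

(** Reduces membership in [H^oo] of a function, or of a conjugate, to vanishing
    Fourier coefficients. *)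
Ltac hinf :=
  repeat match goal with |- _ /\ _ => split end;
  try match goal with
  | |- Hinf _ => rewrite ?barE;
      match goal with
      | |- Hinf (bar _) => apply: Hinf_coanalyticI; [by linf | try assumption]
      | |- Hinf _ => apply: Hinf_analyticI; [by linf | try assumption]
      end
  | |- constant_fun _ =>
      apply/constant_funP; [by apply: Linf_L2; linf | split; try assumption]
  | |- _ => try assumption
  end.

Ltac unhinf := repeat match goal with
  | H : _ /\ _ |- _ => destruct H
  | H : Hinf _ |- _ => rewrite ?barE in H;
      match type of H with
      | Hinf (bar _) => apply Hinf_coanalytic in H
      | Hinf _ => apply Hinf_analytic in H
      end
  | H : constant_fun ?x |- _ =>
      apply constant_funP in H; [destruct H | by apply: Linf_L2; linf]
  end.

Theorem theorem4p3 (R : realType) (f1 u1 g1 v1 f2 u2 g2 v2 : cfun R)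
  (hf1 : Linf f1) (hu1 : Linf u1) (hg1 : Linf g1) (hv1 : Linf v1)
  (hf2 : Linf f2) (hu2 : Linf u2) (hg2 : Linf g2) (hv2 : Linf v2)
  (hWL : zero_op2 (W f1 u1 g1 v1 f2 u2 g2 v2))
  (hWR : zero_op2 (W f2 u2 g2 v2 f1 u1 g1 v1)) :
  commute_on_L2 (cauchy_op f1 u1 g1 v1) (cauchy_op f2 u2 g2 v2) <->
  (* (1) *)
  (Hinf (bar f1) /\ Hinf (bar f2) /\ Hinf g1 /\ Hinf g2 /\
   Hinf (bar u1) /\ Hinf (bar u2) /\ Hinf v1 /\ Hinf v2)
  \/ (* (2) *)
  (Hinf (bar f1) /\ Hinf (bar f2) /\ Hinf g1 /\ Hinf g2 /\ Hinf (bar u2) /\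
   Hinf ((bar f2 \- bar v2) \* bar u1) /\ constant_fun v2)
  \/ (* (2^) *)
  (Hinf (bar f1) /\ Hinf (bar f2) /\ Hinf g1 /\ Hinf g2 /\ Hinf (bar u1) /\
   Hinf ((bar f1 \- bar v1) \* bar u2) /\ constant_fun v1)
  \/ (* (3) *)
  (Hinf g2 /\ Hinf (bar u1) /\ Hinf (bar u2) /\ Hinf v1 /\ Hinf v2 /\
   Hinf ((f2 \- v2) \* g1) /\ constant_fun f2)
  \/ (* (3^) *)
  (Hinf g1 /\ Hinf (bar u1) /\ Hinf (bar u2) /\ Hinf v1 /\ Hinf v2 /\
   Hinf ((f1 \- v1) \* g2) /\ constant_fun f1)
  \/ (* (4) *)
  (Hinf g2 /\ Hinf (bar u2) /\ Hinf ((bar f2 \- bar v2) \* bar u1) /\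
   Hinf ((f2 \- v2) \* g1) /\ constant_fun f2 /\ constant_fun v2)
  \/ (* (4^) *)
  (Hinf g1 /\ Hinf (bar u1) /\ Hinf ((bar f1 \- bar v1) \* bar u2) /\
   Hinf ((f1 \- v1) \* g2) /\ constant_fun f1 /\ constant_fun v1)
  \/ (* (5) *)
  (Hinf (bar f1) /\ Hinf (bar f2) /\ Hinf g1 /\ Hinf g2 /\
   Hinf (bar v1) /\ Hinf (bar v2) /\
   Hinf (((bar f1 \- bar v1) \* bar u2) \- ((bar f2 \- bar v2) \* bar u1)))
  \/ (* (6) *)
  (Hinf g1 /\ Hinf g2 /\ Hinf (bar u1) /\ Hinf (bar u2) /\
   constant_fun f2 /\ constant_fun v1)
  \/ (* (6^) *)
  (Hinf g1 /\ Hinf g2 /\ Hinf (bar u1) /\ Hinf (bar u2) /\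
   constant_fun f1 /\ constant_fun v2)
  \/ (* (7) *)
  (Hinf g1 /\ Hinf g2 /\ Hinf (bar u2) /\ Hinf (bar v1) /\ Hinf (bar v2) /\
   Hinf ((bar f2 \- bar v2) \* bar u1) /\ constant_fun f2)
  \/ (* (7^) *)
  (Hinf g1 /\ Hinf g2 /\ Hinf (bar u1) /\ Hinf (bar v1) /\ Hinf (bar v2) /\
   Hinf ((bar f1 \- bar v1) \* bar u2) /\ constant_fun f1)
  \/ (* (8) *)
  (exists l : R[i], l != 0 /\ Hinf g1 /\ Hinf g2 /\
   Hinf (bar f1 \- (l^* \*o bar u1)) /\ Hinf (bar v2 \- (l^* \*o bar u2)) /\
   Hinf (((bar f1 \* bar f2) \+ (bar v1 \* bar v2)) \- (bar f1 \* bar v2)) /\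
   constant_fun f2 /\ constant_fun v1)
  \/ (* (8^) *)
  (exists m : R[i], m != 0 /\ Hinf g1 /\ Hinf g2 /\
   Hinf (bar f2 \- (m^* \*o bar u2)) /\ Hinf (bar v1 \- (m^* \*o bar u1)) /\
   Hinf (((bar f1 \* bar f2) \+ (bar v1 \* bar v2)) \- (bar f2 \* bar v1)) /\
   constant_fun f1 /\ constant_fun v2)
  \/ (* (9) *)
  (Hinf f1 /\ Hinf f2 /\ Hinf (bar u1) /\ Hinf (bar u2) /\ Hinf v1 /\
   Hinf v2 /\ Hinf (((f2 \- v2) \* g1) \- ((f1 \- v1) \* g2)))
  \/ (* (10) *)
  (Hinf f1 /\ Hinf f2 /\ Hinf g2 /\ Hinf (bar u1) /\ Hinf (bar u2) /\
   Hinf ((f2 \- v2) \* g1) /\ constant_fun v2)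
  \/ (* (10^) *)
  (Hinf f1 /\ Hinf f2 /\ Hinf g1 /\ Hinf (bar u1) /\ Hinf (bar u2) /\
   Hinf ((f1 \- v1) \* g2) /\ constant_fun v1)
  \/ (* (11) *)
  (exists l : R[i], l != 0 /\ Hinf (bar u1) /\ Hinf (bar u2) /\
   Hinf (g1 \- (l \*o v1)) /\ Hinf (g2 \- (l \*o f2)) /\
   Hinf (((f1 \* f2) \+ (v1 \* v2)) \- (v1 \* f2)) /\
   constant_fun f1 /\ constant_fun v2)
  \/ (* (11^) *)
  (exists m : R[i], m != 0 /\ Hinf (bar u1) /\ Hinf (bar u2) /\
   Hinf (g2 \- (m \*o v2)) /\ Hinf (g1 \- (m \*o f1)) /\
   Hinf (((f1 \* f2) \+ (v1 \* v2)) \- (v2 \* f1)) /\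
   constant_fun f2 /\ constant_fun v1)
  \/ (* (12) *)
  (Hinf f1 /\ Hinf f2 /\ Hinf g1 /\ Hinf g2 /\
   Hinf (bar u1) /\ Hinf (bar u2) /\ Hinf (bar v1) /\ Hinf (bar v2))
  \/ (* (13) *)
  (exists l m : R[i], l != 0 /\ m != 0 /\
   Hinf (bar f1 \- (l^* \*o bar u1)) /\ Hinf (g1 \- (l \*o v1)) /\
   Hinf (g2 \- (l \*o f2)) /\ Hinf (bar v2 \- (l^* \*o bar u2)) /\
   Hinf (bar f2 \- (m^* \*o bar u2)) /\ Hinf (g2 \- (m \*o v2)) /\
   Hinf (g1 \- (m \*o f1)) /\ Hinf (bar v1 \- (m^* \*o bar u1)) /\
   constant_fun ((l \*o (f2 \* v1)) \- (m \*o (f1 \* v2)))).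
Proof.
have crit gg uu gg' uu' : has_symbol f1 u1 g1 v1 f2 u2 g2 v2 gg uu -> has_symbol f2 u2 g2 v2 f1 u1 g1 v1 gg' uu' ->
    commute_on_L2 (cauchy_op f1 u1 g1 v1) (cauchy_op f2 u2 g2 v2) <->
    (forall n : int, n < 0 -> gg n = gg' n) /\ (forall n : int, 0 < n -> uu n = uu' n).
  by move=> S S'; exact: (commute_symbols hf1 hu1 hg1 hv1 hf2 hu2 hg2 hv2 S S').
(* [W_L = 0] reads [p (x) q = r (x) s].  PR, PS, QR and QS name the two factors
   that vanish, SC stands for proportional factors; 12 refers to [W_L], and 21
   to [W_R], where the indices are exchanged. *)
have PR12 := has_symbol_PR hf1 hu1 hg1 hv1 hf2 hu2 hg2 hv2.
have PS12 := has_symbol_PS hf1 hu1 hg1 hv1 hf2 hu2 hg2 hv2.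
have QR12 := has_symbol_QR hf1 hu1 hg1 hv1 hf2 hu2 hg2 hv2.
have QS12 := has_symbol_QS hf1 hu1 hg1 hv1 hf2 hu2 hg2 hv2.
have SC12 l := @has_symbol_scalar R _ _ _ _ _ _ _ _ hf1 hu1 hg1 hv1 hf2 hu2 hg2 hv2 l.
have PR21 := has_symbol_PR hf2 hu2 hg2 hv2 hf1 hu1 hg1 hv1.
have PS21 := has_symbol_PS hf2 hu2 hg2 hv2 hf1 hu1 hg1 hv1.
have QR21 := has_symbol_QR hf2 hu2 hg2 hv2 hf1 hu1 hg1 hv1.
have QS21 := has_symbol_QS hf2 hu2 hg2 hv2 hf1 hu1 hg1 hv1.
have SC21 l := @has_symbol_scalar R _ _ _ _ _ _ _ _ hf2 hu2 hg2 hv2 hf1 hu1 hg1 hv1 l.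
have T12 := W_types hf1 hu1 hg1 hv1 hf2 hu2 hg2 hv2 hWL.
have T21 := W_types hf2 hu2 hg2 hv2 hf1 hu1 hg1 hv1 hWR.
split=> [Hc|].
  (* Five cases for each of [W_L] and [W_R].  If the factors of one of them are
     proportional and the other is of type PR (or QS), then the first is in fact
     of type QS (or PR). *)
  case: T12 => [[[[cf1 ag1]|[af2 cu2]] [[cu1 av1]|[ag2 cv2]]]|[l [l0 cfu1 agv1 agf2 cvu2]]];
  case: T21 => [[[[cf2 ag2']|[af1 cu1']] [[cu2' av2]|[ag1' cv1]]]|[m [m0 cfu2 agv2 agf1 cvu1]]].
  - have [G U] := (crit _ _ _ _ (PR12 cf1 ag1 cu1 av1) (PR21 cf2 ag2' cu2' av2)).1 Hc.
    left; hinf; forward G U.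
  - have [G U] := (crit _ _ _ _ (PR12 cf1 ag1 cu1 av1) (PS21 cf2 ag2' ag1' cv1)).1 Hc.
    do 2 right; left; hinf; forward G U.
  - have [G U] := (crit _ _ _ _ (PR12 cf1 ag1 cu1 av1) (QR21 af1 cu1' cu2' av2)).1 Hc.
    do 4 right; left; hinf; forward G U.
  - have [G U] := (crit _ _ _ _ (PR12 cf1 ag1 cu1 av1) (QS21 af1 cu1' ag1' cv1)).1 Hc.
    do 6 right; left; hinf; forward G U.
  - have af1 := analytic_subZr m0 hg1 hf1 agf1 ag1; have cv1 := coanalytic_subZl hv1 hu1 cvu1 cu1.
    have [G U] := (crit _ _ _ _ (PR12 cf1 ag1 cu1 av1) (QS21 af1 cu1 ag1 cv1)).1 Hc.
    do 6 right; left; hinf; forward G U.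
  - have [G U] := (crit _ _ _ _ (PS12 cf1 ag1 ag2 cv2) (PR21 cf2 ag2' cu2' av2)).1 Hc.
    do 1 right; left; hinf; forward G U.
  - have [G U] := (crit _ _ _ _ (PS12 cf1 ag1 ag2 cv2) (PS21 cf2 ag2' ag1' cv1)).1 Hc.
    do 7 right; left; hinf; forward G U.
  - have [G U] := (crit _ _ _ _ (PS12 cf1 ag1 ag2 cv2) (QR21 af1 cu1' cu2' av2)).1 Hc.
    do 9 right; left; hinf; forward G U.
  - have [G U] := (crit _ _ _ _ (PS12 cf1 ag1 ag2 cv2) (QS21 af1 cu1' ag1' cv1)).1 Hc.
    do 11 right; left; hinf; forward G U.
  - have af1 := analytic_subZr m0 hg1 hf1 agf1 ag1; have av2 := analytic_subZr m0 hg2 hv2 agv2 ag2.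
    have [G U] := (crit _ _ _ _ (PS12 cf1 ag1 ag2 cv2) (SC21 _ m0 cfu2 agv2 agf1 cvu1)).1 Hc.
    do 13 right; left; exists m; hinf.
    move=> n n0; expand; have := U n n0 => /=.
    rewrite (mulcoefC f1 f2) (mulcoef_coanalyticZ hf2 hu2 hf1 cfu2 cf1 n0) (mulcoef_coanalyticZ hv1 hu1 hv2 cvu1 cv2 n0); orient.
    by move=> /(congr1 ( *%R m)); rewrite mulVKf // => h; apply: (eq0_of h); ring.
  - have [G U] := (crit _ _ _ _ (QR12 af2 cu2 cu1 av1) (PR21 cf2 ag2' cu2' av2)).1 Hc.
    do 3 right; left; hinf; forward G U.
  - have [G U] := (crit _ _ _ _ (QR12 af2 cu2 cu1 av1) (PS21 cf2 ag2' ag1' cv1)).1 Hc.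
    do 8 right; left; hinf; forward G U.
  - have [G U] := (crit _ _ _ _ (QR12 af2 cu2 cu1 av1) (QR21 af1 cu1' cu2' av2)).1 Hc.
    do 14 right; left; hinf; forward G U.
  - have [G U] := (crit _ _ _ _ (QR12 af2 cu2 cu1 av1) (QS21 af1 cu1' ag1' cv1)).1 Hc.
    do 16 right; left; hinf; forward G U.
  - have cf2 := coanalytic_subZl hf2 hu2 cfu2 cu2; have cv1 := coanalytic_subZl hv1 hu1 cvu1 cu1.
    have [G U] := (crit _ _ _ _ (QR12 af2 cu2 cu1 av1) (SC21 _ m0 cfu2 agv2 agf1 cvu1)).1 Hc.
    do 18 right; left; exists m; hinf.
    move=> n n0; expand; have := G n n0 => /=.
    rewrite (mulcoef_analyticZ hg1 hf1 hf2 agf1 af2 n0) (mulcoefC v1 g2) (mulcoef_analyticZ hg2 hv2 hv1 agv2 av1 n0) -mulrDr; orient.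
    by move=> /(mulfI m0) h; apply: (eq0_of h); ring.
  - have [G U] := (crit _ _ _ _ (QS12 af2 cu2 ag2 cv2) (PR21 cf2 ag2' cu2' av2)).1 Hc.
    do 5 right; left; hinf; forward G U.
  - have [G U] := (crit _ _ _ _ (QS12 af2 cu2 ag2 cv2) (PS21 cf2 ag2' ag1' cv1)).1 Hc.
    do 10 right; left; hinf; forward G U.
  - have [G U] := (crit _ _ _ _ (QS12 af2 cu2 ag2 cv2) (QR21 af1 cu1' cu2' av2)).1 Hc.
    do 15 right; left; hinf; forward G U.
  - have [G U] := (crit _ _ _ _ (QS12 af2 cu2 ag2 cv2) (QS21 af1 cu1' ag1' cv1)).1 Hc.
    do 19 right; left; hinf; forward G U.
  - have cf2 := coanalytic_subZl hf2 hu2 cfu2 cu2; have av2 := analytic_subZr m0 hg2 hv2 agv2 ag2.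
    have [G U] := (crit _ _ _ _ (QS12 af2 cu2 ag2 cv2) (PR21 cf2 ag2 cu2 av2)).1 Hc.
    do 5 right; left; hinf; forward G U.
  - have af2 := analytic_subZr l0 hg2 hf2 agf2 ag2'; have cv2 := coanalytic_subZl hv2 hu2 cvu2 cu2'.
    have [G U] := (crit _ _ _ _ (QS12 af2 cu2' ag2' cv2) (PR21 cf2 ag2' cu2' av2)).1 Hc.
    do 5 right; left; hinf; forward G U.
  - have af2 := analytic_subZr l0 hg2 hf2 agf2 ag2'; have av1 := analytic_subZr l0 hg1 hv1 agv1 ag1'.
    have [G U] := (crit _ _ _ _ (SC12 _ l0 cfu1 agv1 agf2 cvu2) (PS21 cf2 ag2' ag1' cv1)).1 Hc.
    do 12 right; left; exists l; hinf.
    move=> n n0; expand; have := U n n0 => /=.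
    rewrite (mulcoef_coanalyticZ hf1 hu1 hf2 cfu1 cf2 n0) (mulcoefC v1 v2) (mulcoef_coanalyticZ hv2 hu2 hv1 cvu2 cv1 n0); orient.
    by move=> /(congr1 ( *%R l)); rewrite mulVKf // => h; apply: (eq0_of (esym h)); ring.
  - have cf1 := coanalytic_subZl hf1 hu1 cfu1 cu1'; have cv2 := coanalytic_subZl hv2 hu2 cvu2 cu2'.
    have [G U] := (crit _ _ _ _ (SC12 _ l0 cfu1 agv1 agf2 cvu2) (QR21 af1 cu1' cu2' av2)).1 Hc.
    do 17 right; left; exists l; hinf.
    move=> n n0; expand; have := G n n0 => /=.
    rewrite (mulcoef_analyticZ hg2 hf2 hf1 agf2 af1 n0) (mulcoefC v2 g1) (mulcoef_analyticZ hg1 hv1 hv2 agv1 av2 n0) -mulrDr; orient.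
    by move=> /(mulfI l0) h; apply: (eq0_of (esym h)); ring.
  - have cf1 := coanalytic_subZl hf1 hu1 cfu1 cu1'; have av1 := analytic_subZr l0 hg1 hv1 agv1 ag1'.
    have [G U] := (crit _ _ _ _ (PR12 cf1 ag1' cu1' av1) (QS21 af1 cu1' ag1' cv1)).1 Hc.
    do 6 right; left; hinf; forward G U.
  - have [G U] := (crit _ _ _ _ (SC12 _ l0 cfu1 agv1 agf2 cvu2) (SC21 _ m0 cfu2 agv2 agf1 cvu1)).1 Hc.
    do 20 right; exists l, m; hinf.
    + move=> n n0; expand; have := G n n0 => /=; orient; lin.
    + move=> n n0; expand; have := U n n0 => /=; orient.
    move=> /(congr1 ( *%R (l * m))) h; apply: (eq0_of (esym h)); field.
    by rewrite l0 m0.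
  (* Each statement fixes the type of both [W_L] and [W_R], hence the symbols of
     both products. *)
  move=> [H|].
  - unhinf.
    apply: (crit _ _ _ _ (PR12 _ _ _ _) (PR21 _ _ _ _)).2; try assumption; try (by apply: analytic_subI); try (by apply: coanalytic_subI); split; backward.
  move=> [H|].
  - unhinf.
    apply: (crit _ _ _ _ (PS12 _ _ _ _) (PR21 _ _ _ _)).2; try assumption; try (by apply: analytic_subI); try (by apply: coanalytic_subI); split; backward.
  move=> [H|].
  - unhinf.
    apply: (crit _ _ _ _ (PR12 _ _ _ _) (PS21 _ _ _ _)).2; try assumption; try (by apply: analytic_subI); try (by apply: coanalytic_subI); split; backward.
  move=> [H|].
  - unhinf.
    apply: (crit _ _ _ _ (QR12 _ _ _ _) (PR21 _ _ _ _)).2; try assumption; try (by apply: analytic_subI); try (by apply: coanalytic_subI); split; backward.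
  move=> [H|].
  - unhinf.
    apply: (crit _ _ _ _ (PR12 _ _ _ _) (QR21 _ _ _ _)).2; try assumption; try (by apply: analytic_subI); try (by apply: coanalytic_subI); split; backward.
  move=> [H|].
  - unhinf.
    apply: (crit _ _ _ _ (QS12 _ _ _ _) (PR21 _ _ _ _)).2; try assumption; try (by apply: analytic_subI); try (by apply: coanalytic_subI); split; backward.
  move=> [H|].
  - unhinf.
    apply: (crit _ _ _ _ (PR12 _ _ _ _) (QS21 _ _ _ _)).2; try assumption; try (by apply: analytic_subI); try (by apply: coanalytic_subI); split; backward.
  move=> [H|].
  - unhinf.
    apply: (crit _ _ _ _ (PS12 _ _ _ _) (PS21 _ _ _ _)).2; try assumption; try (by apply: analytic_subI); try (by apply: coanalytic_subI); split; backward.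
  move=> [H|].
  - unhinf.
    apply: (crit _ _ _ _ (QR12 _ _ _ _) (PS21 _ _ _ _)).2; try assumption; try (by apply: analytic_subI); try (by apply: coanalytic_subI); split; backward.
  move=> [H|].
  - unhinf.
    apply: (crit _ _ _ _ (PS12 _ _ _ _) (QR21 _ _ _ _)).2; try assumption; try (by apply: analytic_subI); try (by apply: coanalytic_subI); split; backward.
  move=> [H|].
  - unhinf.
    apply: (crit _ _ _ _ (QS12 _ _ _ _) (PS21 _ _ _ _)).2; try assumption; try (by apply: analytic_subI); try (by apply: coanalytic_subI); split; backward.
  move=> [H|].
  - unhinf.
    apply: (crit _ _ _ _ (PS12 _ _ _ _) (QS21 _ _ _ _)).2; try assumption; try (by apply: analytic_subI); try (by apply: coanalytic_subI); split; backward.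
  move=> [H|].
  - case: H => l [l0 H]; unhinf.
    apply: (crit _ _ _ _ (SC12 _ l0 _ _ _ _) (PS21 _ _ _ _)).2; try assumption; try (by apply: analytic_subI); try (by apply: coanalytic_subI); split; first by backward.
    have [cfu1 cvu2 cf2 cv1] : [/\ coanalytic (f1 \- (l \*o u1)), coanalytic (v2 \- (l \*o u2)), coanalytic f2 & coanalytic v1] by [].
    have hM : coanalytic (((f1 \* f2) \+ (v1 \* v2)) \- (f1 \* v2)) by [].
    move=> n n0 /=; apply: (mulfI l0); rewrite mulVKf // mulrDr (mulcoefC f2 u1).
    rewrite -(mulcoef_coanalyticZ hf1 hu1 hf2 cfu1 cf2 n0) -(mulcoef_coanalyticZ hv2 hu2 hv1 cvu2 cv1 n0) (mulcoefC v2 v1).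
    by have := hM n n0; expand => h; apply/esym/(eq_of h).
  move=> [H|].
  - case: H => m [m0 H]; unhinf.
    apply: (crit _ _ _ _ (PS12 _ _ _ _) (SC21 _ m0 _ _ _ _)).2; try assumption; try (by apply: analytic_subI); try (by apply: coanalytic_subI); split; first by backward.
    have [cfu2 cvu1 cf1 cv2] : [/\ coanalytic (f2 \- (m \*o u2)), coanalytic (v1 \- (m \*o u1)), coanalytic f1 & coanalytic v2] by [].
    have hM : coanalytic (((f1 \* f2) \+ (v1 \* v2)) \- (f2 \* v1)) by [].
    move=> n n0 /=; apply: (mulfI m0); rewrite mulVKf // mulrDr (mulcoefC f1 u2).
    rewrite -(mulcoef_coanalyticZ hf2 hu2 hf1 cfu2 cf1 n0) -(mulcoef_coanalyticZ hv1 hu1 hv2 cvu1 cv2 n0) (mulcoefC f2 f1).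
    by have := hM n n0; expand => h; apply: (eq_of h).
  move=> [H|].
  - unhinf.
    apply: (crit _ _ _ _ (QR12 _ _ _ _) (QR21 _ _ _ _)).2; try assumption; try (by apply: analytic_subI); try (by apply: coanalytic_subI); split; backward.
  move=> [H|].
  - unhinf.
    apply: (crit _ _ _ _ (QS12 _ _ _ _) (QR21 _ _ _ _)).2; try assumption; try (by apply: analytic_subI); try (by apply: coanalytic_subI); split; backward.
  move=> [H|].
  - unhinf.
    apply: (crit _ _ _ _ (QR12 _ _ _ _) (QS21 _ _ _ _)).2; try assumption; try (by apply: analytic_subI); try (by apply: coanalytic_subI); split; backward.
  move=> [H|].
  - case: H => l [l0 H]; unhinf.
    apply: (crit _ _ _ _ (SC12 _ l0 _ _ _ _) (QR21 _ _ _ _)).2; try assumption; try (by apply: analytic_subI); try (by apply: coanalytic_subI); split; last by backward.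
    have [agv1 agf2 af1 av2] : [/\ analytic (g1 \- (l \*o v1)), analytic (g2 \- (l \*o f2)), analytic f1 & analytic v2] by [].
    have hM : analytic (((f1 \* f2) \+ (v1 \* v2)) \- (v1 \* f2)) by [].
    move=> n n0 /=; rewrite (mulcoef_analyticZ hg2 hf2 hf1 agf2 af1 n0) (mulcoefC v2 g1).
    rewrite (mulcoef_analyticZ hg1 hv1 hv2 agv1 av2 n0) -mulrDr (mulcoefC f2 f1); congr (_ * _).
    by have := hM n n0; expand => h; apply/esym/(eq_of h).
  move=> [H|].
  - case: H => m [m0 H]; unhinf.
    apply: (crit _ _ _ _ (QR12 _ _ _ _) (SC21 _ m0 _ _ _ _)).2; try assumption; try (by apply: analytic_subI); try (by apply: coanalytic_subI); split; last by backward.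
    have [agv2 agf1 af2 av1] : [/\ analytic (g2 \- (m \*o v2)), analytic (g1 \- (m \*o f1)), analytic f2 & analytic v1] by [].
    have hM : analytic (((f1 \* f2) \+ (v1 \* v2)) \- (v2 \* f1)) by [].
    move=> n n0 /=; rewrite (mulcoef_analyticZ hg1 hf1 hf2 agf1 af2 n0) (mulcoefC v1 g2).
    rewrite (mulcoef_analyticZ hg2 hv2 hv1 agv2 av1 n0) -mulrDr (mulcoefC v2 v1); congr (_ * _).
    by have := hM n n0; expand => h; apply: (eq_of h).
  move=> [H|].
  - unhinf.
    apply: (crit _ _ _ _ (QS12 _ _ _ _) (QS21 _ _ _ _)).2; try assumption; try (by apply: analytic_subI); try (by apply: coanalytic_subI); split; backward.
  move=> H.
  case: H => l [m [l0 [m0 H]]]; unhinf.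
  apply: (crit _ _ _ _ (SC12 _ l0 _ _ _ _) (SC21 _ m0 _ _ _ _)).2; try assumption; try (by apply: analytic_subI); try (by apply: coanalytic_subI); split; first by backward.
  have hM : coanalytic ((l \*o (f2 \* v1)) \- (m \*o (f1 \* v2))) by [].
  move=> n n0 /=; apply: (mulfI l0); rewrite mulVKf //; apply: (mulfI m0).
  rewrite mulrCA mulVKf //.
  by have := hM n n0; expand => h; apply/esym/(eq_of h).
Qed.
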